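(* Let $[X,Y]^{\top}$ be a random element of $L^2\times L^2$ that has mean zero and is jointly regularly varying with index $-\alpha$, where $\alpha>2$, and let $[X_1,Y_1]^{\top},[X_2,Y_2]^{\top},\ldots$ be independent copies of $[X,Y]^{\top}$. Let $k=k(n)$ satisfy $k\to\infty$ and $k/n\to0$ as $n\to\infty$. Put $R_i=\|X_i\|\vee\|Y_i\|$, let $R_{(k)}$ be the $k$th largest value among $R_1,\ldots,R_n$ (so $R_{(1)}=\max\{R_1,\ldots,R_n\}$), and define $$\hat\sigma_{n,k}=\frac1k\sum_{i=1}^n\left\langle \frac{X_i}{R_{(k)}},\frac{Y_i}{R_{(k)}}\right\rangle I_{R_i\ge R_{(k)}},\qquad \sigma_{XY}=\int_{\|x\|\vee\|y\|>1}\langle x,y\rangle\,\mu(dx,dy),$$ where $\mu$ is the normalized joint exponent measure of $[X,Y]^{\top}$. Then $\hat\sigma_{n,k}\to\sigma_{XY}$ in probability as $n\to\infty$.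
   Context: $L^2=L^2(\mathcal T)$, where $\mathcal T$ is a measure space such that $L^2(\mathcal T)$ is a separable real Hilbert space, with inner product $\langle x,y\rangle=\int_{\mathcal T}x(t)y(t)\,dt$ and norm $\|x\|=\langle x,x\rangle^{1/2}$. On $L^2\times L^2$ the norm is $\|(x,y)\|=\|x\|\vee\|y\|$. For a separable Banach space $\mathbb B$, $M_0(\mathbb B)$ is the set of Borel measures on $\mathbb B\setminus\{0\}$ that are finite on Borel sets bounded away from $0$ (sets disjoint from some open ball $\{z:\|z\|<\varepsilon\}$, $\varepsilon>0$). $\mu_n\to\mu$ in $M_0(\mathbb B)$ means $\mu_n(A)\to\mu(A)$ for every Borel set $A$ bounded away from $0$ with $\mu(\partial A)=0$. $[X,Y]^{\top}$ is jointly regularly varying in $L^2\times L^2$ with index $-\alpha$, $\alpha>0$, if there are a sequence $b(n)\to\infty$ and a measure $\mu\in M_0(L^2\times L^2)$ with $\mu(tA)=t^{-\alpha}\mu(A)$ for all $t>0$ and Borel $A$, such that $n\,\mathrm{pr}\big((X,Y)/b(n)\in\cdot\big)\to\mu$ in $M_0(L^2\times L^2)$. $\mu$ is called the joint exponent measure; it is normalized (by choice of $b(n)$) so that $\mu\{(x,y):\|x\|\vee\|y\|>1\}=1$. Standing assumption: both marginals $\mu_X(\cdot)=\mu(\cdot\times L^2)$ and $\mu_Y(\cdot)=\mu(L^2\times\cdot)$ on $L^2\setminus\{0\}$ are non-degenerate (nonzero measures in $M_0(L^2)$). *)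

(* Defs.v *)
From HB Require Import structures.
From mathcomp Require Import all_boot all_order all_algebra finmap.
From mathcomp Require Import all_classical all_reals all_analysis.
From mathcomp Require Import measurable_realfun.
From mathcomp Require Import ring.
Import Order.TTheory GRing.Theory Num.Theory numFieldNormedType.Exports.

Set Implicit Arguments.
Unset Strict Implicit.
Unset Printing Implicit Defensive.

Local Open Scope classical_set_scope.
Local Open Scope ring_scope.

Definition L2 (d : measure_display) (T : measurableType d) (R : realType)
  (nu : {measure set T -> \bar R}) : Type := LspaceType2 nu.

(* A class is coerced to a representative of it; every notion below depends on
   the class only. *)
Definition L2_fun (d : measure_display) (T : measurableType d) (R : realType)
  (nu : {measure set T -> \bar R}) (x : L2 nu) : T -> R :=
  fun t => LebesgueSpace.sort x t.
Coercion L2_fun : L2 >-> Funclass.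

Definition inner (d : measure_display) (T : measurableType d) (R : realType)
  (nu : {measure set T -> \bar R}) (x y : L2 nu) : R :=
  \int[nu]_t (x t * y t).

HB.instance Definition _ (d : measure_display) (T : measurableType d)
  (R : realType) (nu : {measure set T -> \bar R}) := gen_eqMixin (L2 nu).
HB.instance Definition _ (d : measure_display) (T : measurableType d)
  (R : realType) (nu : {measure set T -> \bar R}) := gen_choiceMixin (L2 nu).

Section L2_construction.
Context (d : measure_display) (T : measurableType d) (R : realType)
  (nu : {measure set T -> \bar R}).
Implicit Types (x y z : L2 nu) (f g : T -> R).

Lemma L2_Lfun x : (x : T -> R) \in Lfun nu 2.
Proof.
rewrite inE; apply/andP; split; rewrite inE/=.
  exact: (@measurable_funPT _ _ T (measurableTypeR R) (repr (LebesgueSpace.sort x))).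
exact: (@Lebesgue_finite _ _ _ _ _ _ x).
Qed.

Lemma L2_measurable x : measurable_fun setT (x : T -> R).
Proof. by have := L2_Lfun x; rewrite inE => /andP[/[!inE]]. Qed.

Lemma L2_ext x y : (x : T -> R) = y %[ae nu] -> x = y.
Proof.
case: x => x [[xf]]; case: y => y [[yf]] => /= xy.
have exy : x = y.
  apply/eqP; rewrite -[x]reprK -[y]reprK; apply/eqP/eqquotP.
  exact/asboolP.
subst y; congr LebesgueSpace.Pack; congr LebesgueSpace.Class.
by congr isFinLebesgue.phant_Build; exact: Prop_irrelevance.
Qed.

Lemma Lnorm2E f :
  Lnorm nu 2 (EFin \o f) = ((\int[nu]_t (f t ^+ 2)%:E) `^ 2^-1)%E.
Proof.
rewrite unlock; congr (_ `^ _)%E; apply: eq_integral => t _.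
by rewrite /= (powR_mulrn 2)// -normrX ger0_norm ?sqr_ge0.
Qed.

Section mkL2.
Variables (f : T -> measurableTypeR R) (fL : (f : T -> R) \in Lfun nu 2).

Let f_meas : measurable_fun setT f.
Proof. by have := fL; rewrite inE => /andP[/[!inE]]. Qed.

HB.instance Definition _ := isMeasurableFun.Build _ _ _ _ f f_meas.

Let q : {mfun_ nu, T >-> measurableTypeR R} :=
  (\pi_({mfun_ nu, T >-> measurableTypeR R}) [the {mfun T >-> _} of f])%qT.

Let qE : (repr q : T -> R) = f %[ae nu].
Proof.
apply/asboolP; rewrite -/(ae_eq_op nu (repr q) [the {mfun T >-> _} of f]).
by apply/(@eqquotP _ _ {mfun_ nu, T >-> measurableTypeR R}); rewrite reprK.
Qed.

Let q_fin : finite_norm nu 2 (repr q).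
Proof.
have := fL; rewrite inE => /andP[_ /[!inE]]/=.
rewrite /finite_norm !Lnorm2E; congr (_ `^ _ < +oo)%E.
apply: ae_eq_integral => //.
- apply/measurable_EFinP; apply: measurable_funX.
  exact: f_meas.
- apply/measurable_EFinP; apply: measurable_funX.
  exact: (@measurable_funPT _ _ T (measurableTypeR R) (repr q)).
- by apply: filterS qE => t /(_ I) /= ->.
Qed.

HB.instance Definition _ := isFinLebesgue.Build _ _ _ nu _ (lee1n 2) q q_fin.

Definition mkL2 : L2 nu := [the LspaceType2 nu of q].

Lemma mkL2E : (mkL2 : T -> R) = f %[ae nu].
Proof. exact: qE. Qed.
End mkL2.

Lemma Lfun2_lin (a : R) f g : f \in Lfun nu 2 -> g \in Lfun nu 2 ->
  (fun t => a * f t + g t) \in Lfun nu 2.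
Proof. by case: (Lfun_submod_closed nu (lee1n 2)) => _; exact. Qed.

Lemma Lfun2_cst0 : (cst 0 : T -> R) \in Lfun nu 2.
Proof. by case: (Lfun_submod_closed nu (lee1n 2)). Qed.

Lemma Lfun2_scale (a : R) x : (fun t => a * x t) \in Lfun nu 2.
Proof.
have := Lfun2_lin a (L2_Lfun x) Lfun2_cst0.
by under eq_fun do rewrite addr0.
Qed.

Lemma Lfun2_add x y : (fun t => x t + y t) \in Lfun nu 2.
Proof.
have := Lfun2_lin 1 (L2_Lfun x) (L2_Lfun y).
by under eq_fun do rewrite mul1r.
Qed.

(* The library gives LspaceType no algebraic structure: the vector space and
   norm below are those of the quotient of square-integrable functions by
   almost-everywhere equality. *)
Definition L2_zero : L2 nu := mkL2 Lfun2_cst0.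
Definition L2_add x y : L2 nu := mkL2 (Lfun2_add x y).
Definition L2_scale (a : R) x : L2 nu := mkL2 (Lfun2_scale a x).
Definition L2_opp x : L2 nu := L2_scale (- 1) x.

Lemma L2_zeroE : (L2_zero : T -> R) = (fun=> 0) %[ae nu].
Proof. exact: mkL2E. Qed.
Lemma L2_addE x y : (L2_add x y : T -> R) = (fun t => x t + y t) %[ae nu].
Proof. exact: mkL2E. Qed.
Lemma L2_scaleE a x : (L2_scale a x : T -> R) = (fun t => a * x t) %[ae nu].
Proof. exact: mkL2E. Qed.

Lemma L2_addA : associative L2_add.
Proof.
move=> x y z; apply: L2_ext; near=> t => _.
rewrite (near (L2_addE x (L2_add y z)) t)// (near (L2_addE y z) t)//.
by rewrite (near (L2_addE (L2_add x y) z) t)// (near (L2_addE x y) t)// addrA.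
Unshelve. all: by end_near. Qed.

Lemma L2_addC : commutative L2_add.
Proof.
move=> x y; apply: L2_ext; near=> t => _.
by rewrite (near (L2_addE x y) t)// (near (L2_addE y x) t)// addrC.
Unshelve. all: by end_near. Qed.

Lemma L2_add0 : left_id L2_zero L2_add.
Proof.
move=> x; apply: L2_ext; near=> t => _.
by rewrite (near (L2_addE L2_zero x) t)// (near L2_zeroE t)// add0r.
Unshelve. all: by end_near. Qed.

Lemma L2_addN : left_inverse L2_zero L2_opp L2_add.
Proof.
move=> x; apply: L2_ext; near=> t => _.
rewrite (near (L2_addE (L2_opp x) x) t)// (near (L2_scaleE (- 1) x) t)//.
by rewrite (near L2_zeroE t)// mulN1r addNr.
Unshelve. all: by end_near. Qed.

Lemma L2_scaleA a b x : L2_scale a (L2_scale b x) = L2_scale (a * b) x.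
Proof.
apply: L2_ext; near=> t => _.
rewrite (near (L2_scaleE a (L2_scale b x)) t)// (near (L2_scaleE b x) t)//.
by rewrite (near (L2_scaleE (a * b) x) t)// mulrA.
Unshelve. all: by end_near. Qed.

Lemma L2_scale1 : left_id 1 L2_scale.
Proof.
move=> x; apply: L2_ext; near=> t => _.
by rewrite (near (L2_scaleE 1 x) t)// mul1r.
Unshelve. all: by end_near. Qed.

Lemma L2_scaleDr : right_distributive L2_scale L2_add.
Proof.
move=> a x y; apply: L2_ext; near=> t => _.
rewrite (near (L2_scaleE a (L2_add x y)) t)// (near (L2_addE x y) t)//.
rewrite (near (L2_addE (L2_scale a x) (L2_scale a y)) t)//.
by rewrite (near (L2_scaleE a x) t)// (near (L2_scaleE a y) t)// mulrDr.
Unshelve. all: by end_near. Qed.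

Lemma L2_scaleDl x a b :
  L2_scale (a + b) x = L2_add (L2_scale a x) (L2_scale b x).
Proof.
apply: L2_ext; near=> t => _.
rewrite (near (L2_scaleE (a + b) x) t)//.
rewrite (near (L2_addE (L2_scale a x) (L2_scale b x)) t)//.
by rewrite (near (L2_scaleE a x) t)// (near (L2_scaleE b x) t)// mulrDl.
Unshelve. all: by end_near. Qed.

HB.instance Definition _ :=
  GRing.isZmodule.Build (L2 nu) L2_addA L2_addC L2_add0 L2_addN.
HB.instance Definition _ := GRing.Zmodule_isLmodule.Build R (L2 nu)
  L2_scaleA L2_scale1 L2_scaleDr L2_scaleDl.

Definition L2_norm x : R := Num.sqrt (inner x x).

Lemma L2_norm_Lnorm x : (L2_norm x)%:E = Lnorm nu 2 (EFin \o x).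
Proof.
have ix := Lfun2_integrable_sqr (L2_Lfun x).
rewrite Lnorm2E -[X in (X `^ _)%E]fineK ?integrable_fin_num//.
rewrite poweR_EFin powR12_sqrt; last first.
  by apply: fine_ge0; apply: integral_ge0 => t _; rewrite lee_fin sqr_ge0.
by rewrite /L2_norm /inner; under eq_Rintegral do rewrite -expr2.
Qed.

Lemma L2_ler_normD x y : L2_norm (x + y) <= L2_norm x + L2_norm y.
Proof.
rewrite -lee_fin EFinD !L2_norm_Lnorm.
apply: le_trans (@minkowski_EFin _ _ _ nu x y 2 _ _ _) => //.
- rewrite !Lnorm2E; rewrite le_eqVlt; apply/orP; left; apply/eqP.
  congr (_ `^ _)%E; apply: ae_eq_integral => //.
  + apply/measurable_EFinP; apply: measurable_funX; exact: L2_measurable.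
  + apply/measurable_EFinP; apply: measurable_funX; apply: measurable_funD; exact: L2_measurable.
  + by apply: filterS (L2_addE x y) => t /(_ I) /= ->.
- exact: L2_measurable.
- exact: L2_measurable.
- by rewrite ler1n.
Qed.

Lemma L2_normZ (a : R) x : L2_norm (a *: x) = `|a| * L2_norm x.
Proof.
rewrite /L2_norm -(sqrtr_sqr a) -sqrtrM ?sqr_ge0//; congr Num.sqrt.
rewrite /inner -RintegralZl//; last first.
  by have := Lfun2_integrable_sqr (L2_Lfun x).
congr fine; apply: ae_eq_integral => //.
- by apply/measurable_EFinP; apply: measurable_funM; exact: L2_measurable.
- apply/measurable_EFinP; apply: measurable_funM => //.
  by apply: measurable_funM; exact: L2_measurable.
- apply: filterS (L2_scaleE a x) => t /(_ I) ax _ /=.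
  by rewrite (ax : L2_fun (a *: x) t = a * x t); congr EFin; ring.
Qed.

Lemma L2_norm_eq0 x : L2_norm x = 0 -> x = 0.
Proof.
move=> xn0; have x0 := L2_norm_Lnorm x; rewrite xn0 in x0; move/esym: x0 => x0.
apply: L2_ext.
have mx : measurable_fun setT (EFin \o (x : T -> R)).
  by apply/measurable_EFinP; exact: L2_measurable.
have x00 : EFin \o (x : T -> R) = cst 0%E %[ae nu].
  by apply: (Lnorm_eq0_eq0 mx _ x0); rewrite lte_fin.
near=> t => _; rewrite -[RHS]/(L2_zero t) (near L2_zeroE t)//.
by apply/EFin_inj; exact: (near x00 t).
Unshelve. all: by end_near. Qed.

HB.instance Definition _ := Lmodule_isNormed.Build R (L2 nu)
  L2_ler_normD L2_normZ L2_norm_eq0.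

End L2_construction.

Notation Borel V := (g_sigma_algebraType (@open V)).

Section regular_variation.
Context (R : realType) (V : normedModType R).

Definition separable : Prop := exists2 D : set V, countable D & dense D.

Definition boundary (A : set V) : set V := closure A `\` A^°.

Definition bounded_away_from_0 (A : set V) : Prop :=
  exists2 e : R, 0 < e & [set z | `|z| < e] `&` A = set0.

(* Measures on V \ {0} are encoded as measures on V that do not charge {0}. *)
Definition in_M0 (mu : {measure set (Borel V) -> \bar R}) : Prop :=
  mu [set 0] = 0%E /\
  forall A : set (Borel V), measurable A -> bounded_away_from_0 A ->
    (mu A < +oo)%E.

Definition M0_cvg (mu_ : nat -> set V -> \bar R)
    (mu : {measure set (Borel V) -> \bar R}) : Prop :=
  forall A : set (Borel V), measurable A -> bounded_away_from_0 A ->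
    mu (boundary A) = 0%E -> mu_ n A @[n --> \oo] --> mu A.

Context (d : measure_display) (Omega : measurableType d)
  (P : probability Omega R).
Implicit Types (Z : Omega -> V) (mu : {measure set (Borel V) -> \bar R}).

Definition random_element Z : Prop :=
  measurable_fun setT (Z : Omega -> Borel V).

Definition exponent_measure Z (alpha : R) mu : Prop :=
  [/\ 0 < alpha, in_M0 mu,
      (forall (t : R) (A : set (Borel V)), 0 < t -> measurable A ->
         mu [set t *: z | z in A] = ((t `^ (- alpha))%:E * mu A)%E) &
      exists2 b : nat -> R, b n @[n --> \oo] --> +oo &
        M0_cvg
          (fun n A => (n%:R%:E * P [set w | A ((b n)^-1 *: Z w)])%E) mu].

Definition normalized mu : Prop := mu [set z | 1 < `|z|] = 1%E.

Definition mutually_independent (Zs : nat -> Omega -> V) : Prop :=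
  forall (J : {fset nat}) (A : nat -> set (Borel V)),
    (forall i, measurable (A i)) ->
    P (\bigcap_(i in [set` J]) (Zs i @^-1` A i)) =
    (\prod_(i <- J) P (Zs i @^-1` A i))%E.

Definition independent_copies Z (Zs : nat -> Omega -> V) : Prop :=
  [/\ (forall i, random_element (Zs i)),
      (forall i (A : set (Borel V)), measurable A ->
         P (Zs i @^-1` A) = P (Z @^-1` A)) &
      mutually_independent Zs].

End regular_variation.
Arguments separable {R} V.

Definition cvg_in_probability (R : realType) (d : measure_display)
    (Omega : measurableType d) (P : probability Omega R)
    (S : nat -> Omega -> R) (s : R) : Prop :=
  forall e : R, 0 < e -> P [set w | e < `|S n w - s|] @[n --> \oo] --> 0%E.

(* For k = 1 this is the maximum of r 0, ..., r n.-1 (when n > 0). The value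
   is meaningful for 1 <= k <= n only. *)
Definition kth_largest (R : realType) (r : nat -> R) (n k : nat) : R :=
  nth 0 (sort >=%R [seq r i | i <- iota 0 n]) k.-1.

Section L2_pairs.
Context (R : realType) (d : measure_display) (T : measurableType d)
  (nu : {measure set T -> \bar R}).

(* The norm of the product normed module is the maximum of the norms, and its
   topology is the product topology. *)
Lemma L2_pair_normE (x y : L2 nu) : `|(x, y)| = Num.max `|x| `|y|.
Proof. by []. Qed.

Lemma L2_normE (x : L2 nu) : `|x| = Num.sqrt (inner x x).
Proof. by []. Qed.

(* The mean of X is the element m of L2 with E<X, h> = <m, h> for every h,
   under E||X|| < oo. *)
Definition has_mean (d' : measure_display) (Omega : measurableType d')
    (P : probability Omega R) (X : Omega -> L2 nu) (m : L2 nu) : Prop :=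
  P.-integrable setT (fun w => (`|X w|)%:E) /\
  forall h : L2 nu, ('E_P[fun w => inner (X w) h] = (inner m h)%:E)%E.

(* mu_X and mu_Y inherit from mu the finiteness required in M_0(L2), so that
   non-degeneracy of the marginals is their not vanishing away from 0. *)
Definition nondegenerate_marginals
    (mu : {measure set (Borel (L2 nu * L2 nu)%type) -> \bar R}) : Prop :=
  (exists A : set (Borel (L2 nu)),
     [/\ measurable A, ~ A 0 & mu (A `*` setT) != 0%E]) /\
  (exists A : set (Borel (L2 nu)),
     [/\ measurable A, ~ A 0 & mu (setT `*` A) != 0%E]).

Definition sigma_hat (x y : nat -> L2 nu) (n k : nat) : R :=
  let r i := Num.max `|x i| `|y i| in
  let rk := kth_largest r n k in
  k%:R^-1 *
  \sum_(i < n) inner (rk^-1 *: x i) (rk^-1 *: y i) * (rk <= r i)%R%:R.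

Definition sigma_XY
    (mu : {measure set (Borel (L2 nu * L2 nu)%type) -> \bar R}) : R :=
  \int[mu]_(z in [set z | 1 < Num.max `|z.1| `|z.2|]) inner z.1 z.2.

End L2_pairs.

(* Main.v *)
Require Import Defs.
From HB Require Import structures.
From mathcomp Require Import all_boot all_order all_algebra finmap.
From mathcomp Require Import all_classical all_reals all_analysis.
From mathcomp Require Import measurable_realfun.
From mathcomp Require Import ring lra.
Import Order.TTheory GRing.Theory Num.Theory numFieldNormedType.Exports.

(** Three facts about regular variation carry the proof. Let [Z] be the pair of
    [X] and [Y], with the maximum norm, and write [c n = b (n %/ k n)] for the
    deterministic level that about [k n] of the first [n] norms exceed; then
    [n / k n * P (Z / c n \in A)] tends to [mu A] for the continuity sets [A] of
    [mu] bounded away from 0 ([tail_mean_cvg]).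

    First, the number of rescaled observations falling in such an [A], divided by
    [k n], tends to [mu A] in probability: its mean does, and its variance is at
    most its mean over [k n] ([tail_count_cvg], through [count_chebyshev]).

    Second, the second moment of the tail beyond a high multiple [M] of the level
    is negligible uniformly in [n]. Since [2 < alpha], doubling a large threshold
    divides the probability of exceeding it by at least [4 / q] for some [q < 1]
    ([regular_tail_dyadic]); summing over dyadic shells bounds the integral of
    the squared norm beyond [t] by a constant times [t ^ 2] times the probability
    of exceeding [t] ([dyadic_tail]). The same bound applies to [mu].

    Third, [mu] is homogeneous, so it does not charge the level sets, at positive
    levels, of a positively homogeneous continuous function bounded by the norm
    ([measure_level]). This applies to the norm and to the square root of the
    positive part of the inner product, whose superlevel sets are therefore
    continuity sets.

    Approximating the positive and negative parts of the inner product from below by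
    a staircase over their superlevel sets reduces its average over the tail to the first fact, the second one
    controlling what the staircase misses: the averages over
    observations beyond [c n] tend to the integral
    ([sample_functional_cvg], [deterministic_threshold_cvg]).
    Counting in the sets of norm at least [u], for [u] close to 1, shows that the
    random threshold is equivalent to [c n] ([threshold_ratio]). Replacing one
    threshold by the other only affects the observations in a thin shell around
    the unit sphere, of which there are few ([threshold_exchange]), and
    homogeneity absorbs the change of scale ([random_threshold_cvg]).

    All this holds in any normed space, for a continuous function that is
    homogeneous of degree 2 and bounded by the squared norm. The inner product is
    such a function on pairs: by polarization, its continuity and the
    Cauchy-Schwarz inequality follow from properties of the norm. *)

Set Implicit Arguments.
Unset Strict Implicit.
Unset Printing Implicit Defensive.

Local Open Scope classical_set_scope.
Local Open Scope ring_scope.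

(** * Superlevel sets *)

Lemma indic_pred (R : realType) (T : Type) (p : pred T) (x : T) :
  \1_[set y | p y] x = (p x)%:R :> R.
Proof. by rewrite indicE; congr (nat_of_bool _)%:R; apply/idP/idP; rewrite inE. Qed.

Lemma measurable_superlevel_ge (R : realType) (d : measure_display)
  (T : measurableType d) (f : T -> R) (u : R) :
  measurable_fun setT f -> measurable [set x | u <= f x].
Proof.
move=> mf; have := mf measurableT _ (measurable_itv `[u, +oo[).
rewrite setTI; congr measurable.
by apply/seteqP; split=> x /=; rewrite in_itv/= andbT.
Qed.

Lemma measurable_superlevel_gt (R : realType) (d : measure_display)
  (T : measurableType d) (f : T -> R) (u : R) :
  measurable_fun setT f -> measurable [set x | u < f x].
Proof.
move=> mf; have := mf measurableT _ (measurable_itv `]u, +oo[).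
rewrite setTI; congr measurable.
by apply/seteqP; split=> x /=; rewrite in_itv/= andbT.
Qed.

(** * Convergence in probability as convergence along a filter *)

Section with_high_probability.
Context (R : realType) (d : measure_display) (Omega : measurableType d)
  (P : probability Omega R).

(** Events in this filter have probability tending to 1 as [n] grows. Stating this
    through a set of small probability for each tolerance, instead of one sequence
    of exceptional sets of vanishing probability, makes estimates that hold for
    each tolerance at a different truncation level usable directly. An event only has
    to contain the complement of a measurable set, so that its own measurability
    is never at stake. Convergence of a random sequence along this filter is convergence in
    probability, with the whole calculus of limits at hand. *)
Definition whp : set_system (nat * Omega) := [set E | forall e : R, 0 < e ->
  exists F : nat -> set Omega,
    [/\ forall n, measurable (F n),
        \forall n \near \oo, (P (F n) <= e%:E)%E &
        \forall n \near \oo, forall w, ~ F n w -> E (n, w)]].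

Global Instance whp_filter : Filter whp.
Proof.
split.
- move=> e e0; exists (fun=> set0); split => //; last exact: nearW.
  by apply: nearW => n; rewrite measure0 lee_fin ltW.
- move=> A B wA wB e e0.
  have e2 : 0 < e / 2 by rewrite divr_gt0.
  have [F [mF PF FA]] := wA _ e2; have [G [mG PG GB]] := wB _ e2.
  exists (fun n => F n `|` G n); split=> [n||]; first exact: measurableU.
  - near=> n; apply: le_trans (measureU2 P (mF n) (mG n)) _.
    by rewrite (splitr e) EFinD leeD//; near: n.
  - near=> n => w /not_orP[nF nG]; split.
      by apply: (near FA n).
    by apply: (near GB n).
- move=> A B AB wA e /wA[F [mF PF FA]]; exists F; split=> //.
  by apply: filterS FA => n FA w /FA/AB.
Unshelve. all: by end_near. Qed.

Lemma whp_near (A : set nat) : (\forall n \near \oo, A n) ->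
  \forall p \near whp, A p.1.
Proof.
move=> oA e e0; exists (fun=> set0); split => //.
  by apply: nearW => n; rewrite measure0 lee_fin ltW.
by apply: filterS oA => n An w _.
Qed.

Lemma whp_event (F : nat -> set Omega) : (forall n, measurable (F n)) ->
  P (F n) @[n --> \oo] --> 0%E -> \forall p \near whp, ~ F p.1 p.2.
Proof.
move=> mF F0 e e0; exists F; split => //; last exact: nearW.
move/fine_cvgP: F0 => [Ffin /cvgr_lt/(_ e e0)].
apply: filterS2 Ffin => n Ffin /ltW.
by rewrite -lee_fin fineK.
Qed.

Lemma whp_cvg_in_probability (S : nat -> Omega -> R) (s : R) :
  (forall n, measurable_fun setT (S n)) ->
  S p.1 p.2 @[p --> whp] --> s -> cvg_in_probability P S s.
Proof.
move=> mS /cvgrPdist_le Ss e e0.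
have mE n : measurable [set w | e < `|S n w - s|].
  apply: measurable_superlevel_gt; apply: measurableT_comp => //.
  exact: measurable_funB.
apply/fine_cvgP; split.
  by apply: nearW => n; rewrite fin_num_measure.
apply/cvgrPdist_le => h h0.
have [F [mF PF FA]] := Ss e e0 h h0.
near=> n.
rewrite sub0r normrN /= ger0_norm ?fine_ge0//.
rewrite -lee_fin fineK ?fin_num_measure//.
apply: (@le_trans _ _ (P (F n))); last by near: n.
apply: le_measure; rewrite ?inE// => w /=.
rewrite ltNge; apply: contraNP => nFw.
by rewrite distrC; apply: (near FA n).
Unshelve. all: by end_near. Qed.

(** The exceptional sets [F] may depend on the tolerance [e'] together with the
    approximating sequence: this is how a truncation at a level depending on
    [e'] enters. *)
Lemma whp_cvg_approx (S : nat -> Omega -> R) (s : R) :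
  (forall e e' : R, 0 < e -> 0 < e' ->
    exists S' s' F,
      [/\ S' p.1 p.2 @[p --> whp] --> s', `|s - s'| <= e,
          forall n, measurable (F n), \forall n \near \oo, (P (F n) <= e'%:E)%E &
          \forall p \near whp, ~ F p.1 p.2 -> `|S p.1 p.2 - S' p.1 p.2| <= e]) ->
  S p.1 p.2 @[p --> whp] --> s.
Proof.
move=> H; apply/cvgrPdist_le => e e0 e' e'0.
have e3 : 0 < e / 3 by rewrite divr_gt0.
have e2 : 0 < e' / 2 by rewrite divr_gt0.
have [S' [s' [F [/cvgrPdist_le/(_ _ e3) S's ss' mF PF SS']]]] := H _ _ e3 e2.
have [G [mG PG GB]] := filterI S's SS' _ e2.
exists (fun n => F n `|` G n); split=> [n||]; first exact: measurableU.
- near=> n; apply: le_trans (measureU2 P (mF n) (mG n)) _.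
  by rewrite (splitr e') EFinD leeD//; near: n.
- apply: filterS GB => n GB w /not_orP[nF /GB/= [H1 /(_ nF)]].
  have := ler_distD s' s (S n w); have := ler_distD (S' n w) s' (S n w).
  by rewrite (distrC (S' n w)); lra.
Unshelve. all: by end_near. Qed.
End with_high_probability.

(** * Chebyshev inequality for counts of pairwise independent events *)

Section pairwise_independent_count.
Context (R : realType) (d : measure_display) (Omega : measurableType d)
  (P : probability Omega R).
Variables (E : nat -> set Omega) (p : R).
Hypotheses (mE : forall i, measurable (E i)) (PE : forall i, P (E i) = p%:E)
  (PEI : forall i j, i != j -> P (E i `&` E j) = (p * p)%:E).

Let count n : Omega -> R := fun w => \sum_(i < n) \1_(E i) w.

Let count_measurable n : measurable_fun setT (count n).
Proof. by apply: measurable_sum => i; exact: measurable_indic. Qed.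

Let indic_Lfun (A : set Omega) : measurable A ->
  (\1_A : Omega -> R) \in Lfun P 2%:E.
Proof.
move=> mA; rewrite inE; apply/andP; split; rewrite inE/=; first exact: measurable_indic.
rewrite /finite_norm Lnorm2E poweR_lty//.
under eq_integral do rewrite indicE expr2 -natrM mulnb andbb -indicE.
by rewrite integral_indic// setIT ltey_eq fin_num_measure.
Qed.

Let E_Lfun i : (\1_(E i) : Omega -> R) \in Lfun P 2%:E := indic_Lfun (mE i).

Let count0 : count 0 = cst 0.
Proof. by apply/funext => w; rewrite /count big_ord0. Qed.

Let countS n : count n.+1 = (count n \+ \1_(E n))%R.
Proof. by apply/funext => w; rewrite /count big_ord_recr. Qed.

Let count_Lfun n : count n \in Lfun P 2%:E.
Proof.
elim: n => [|n ih]; first by rewrite count0 Lfun_cst.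
by rewrite countS rpredD ?lee1n//=.
Qed.

Let Pfin : P setT \is a fin_num := fin_num_measure P _ measurableT.

Let count_expectation n : ('E_P[count n])%E = (n%:R * p)%:E.
Proof.
elim: n => [|n ih]; first by rewrite count0 expectation_cst mul0r.
rewrite countS expectationD ?Lfun_subset12// ih expectation_indic// PE.
by rewrite -EFinD -natr1 mulrDl mul1r.
Qed.

Let count_covariance n m : (n <= m)%N ->
  covariance P (count n) \1_(E m) = 0%E.
Proof.
elim: n => [_|n ih nm]; first by rewrite count0 covariance_cst_l.
rewrite countS covarianceDl// ih ?(ltnW nm)// add0e covarianceE ?Lfun_subset12//.
  rewrite (_ : \1_(E n) * \1_(E m) = \1_(E n `&` E m))%R; last first.
    by rewrite indicI.
  rewrite !expectation_indic//; last exact: measurableI.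
  by rewrite PEI ?PE ?EFinM ?subee// neq_ltn nm.
rewrite (_ : \1_(E n) * _ = \1_(E n `&` E m))%R; last by rewrite indicI.
exact: (indic_Lfun (measurableI _ _ (mE n) (mE m))).
Qed.

Let count_variance n : ('V_P[count n] <= (n%:R * p)%:E)%E.
Proof.
elim: n => [|n ih]; first by rewrite count0 variance_cst mul0r.
rewrite countS varianceD// count_covariance// mule0 adde0.
rewrite -natr1 mulrDl mul1r EFinD leeD// varianceE//.
rewrite (_ : \1_(E n) ^+ 2 = \1_(E n))%R; last first.
  by rewrite -[in RHS](setIid (E n)) indicI expr2.
rewrite expectation_indic// PE leeBlDr// leeDl//.
by rewrite sqre_ge0.
Qed.

Lemma count_chebyshev n (e : R) : 0 < e ->
  (P [set w | (e <= `|\sum_(i < n) \1_(E i) w - n%:R * p|)%R] <=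
   (n%:R * p / e ^+ 2)%:E)%E.
Proof.
move=> e0.
pose X : {mfun Omega >-> R} :=
  HB.pack (count n) (isMeasurableFun.Build _ _ _ _ _ (count_measurable n)).
have := @chebyshev _ _ _ P X _ e0.
rewrite (_ : 'E_P[X] = (n%:R * p)%:E)%E; last exact: count_expectation.
move=> /le_trans; apply.
rewrite mulrC EFinM lee_wpmul2l//; first by rewrite lee_fin invr_ge0 exprn_ge0// ltW.
exact: count_variance.
Qed.

End pairwise_independent_count.

(** * Borel sets and boundaries in a normed space *)

Section borel_sets.
Context (R : realType) (V : normedModType R).
Implicit Types (f : V -> R) (A B : set V).

Lemma open_Borel A : open A -> measurable (A : set (Borel V)).
Proof. by move=> oA; exact: sub_sigma_algebra. Qed.

Lemma closed_Borel A : closed A -> measurable (A : set (Borel V)).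
Proof.
move=> cA; rewrite -[A]setCK; apply: measurableC.
by apply: open_Borel; exact: closed_openC.
Qed.

Lemma continuous_Borel f : continuous f ->
  measurable_fun setT (f : Borel V -> R).
Proof.
move=> cf; apply: (measurability _ (RGenOpens.measurableE R)) => _ [_ [a [b ->]] <-].
rewrite setTI; apply: open_Borel.
by apply: open_comp => // x _; exact: cf.
Qed.

Lemma measurable_level f u : continuous f ->
  measurable ([set z | f z = u] : set (Borel V)).
Proof.
move=> cf; have := continuous_Borel cf measurableT (measurable_set1 u).
by rewrite setTI.
Qed.

Lemma boundaryI A B :
  boundary (A `&` B) `<=` boundary A `|` boundary B.
Proof.
move=> z [clAB nint].
have clA : closure A z by apply: closureS clAB; exact: subIsetl.
have clB : closure B z by apply: closureS clAB; exact: subIsetr.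
have [iA|nA] := pselect ((A°)%classic z); last by left; split.
right; split => // iB; apply: nint; rewrite interiorI; split => //.
Qed.

Lemma closed_superlevel f u : continuous f -> closed [set z | u <= f z].
Proof.
by move=> cf; apply: (preimage_closed (f := f) _ (@closed_ge R u)) => z _; exact: cf.
Qed.

(** By continuity the strict superlevel set is open and the large one closed. *)
Lemma boundary_superlevel f u C : continuous f ->
  [set z | u < f z] `<=` C -> C `<=` [set z | u <= f z] ->
  boundary C `<=` [set z | f z = u].
Proof.
move=> cf fC Cf z [/(closureS Cf) clz nint] /=; apply/eqP; rewrite eq_le.
apply/andP; split; last exact: (closed_superlevel cf) clz.
rewrite leNgt; apply/negP => uz; apply: nint.
by apply: filterS (cvgr_gt _ (cf z) _ uz) => y /fC.
Qed.

Lemma bounded_away_ge (u : R) A :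
  0 < u -> A `<=` [set z | u <= `|z|] -> bounded_away_from_0 A.
Proof.
move=> u0 Au; exists u => //; rewrite -subset0 => z [/= zu /Au/=].
by rewrite leNgt zu.
Qed.

Lemma boundary_null (mu : {measure set (Borel V) -> \bar R}) A (N : set V) :
  measurable (N : set (Borel V)) -> mu N = 0%E -> boundary A `<=` N ->
  mu (boundary A) = 0%E.
Proof.
move=> mN N0 AN; apply/eqP; rewrite eq_le measure_ge0 andbT -N0.
apply: le_measure; rewrite ?inE//; apply: measurableD.
  by apply: closed_Borel; exact: closed_closure.
by apply: open_Borel; exact: open_interior.
Qed.

End borel_sets.

(** * Intermediate sequences *)

Section intermediate_sequence.
Context (R : realType) (k : nat -> nat).
Hypotheses (k_cvgy : k n @[n --> \oo] --> \oo)
  (kn_cvg0 : (k n)%:R / n%:R @[n --> \oo] --> (0 : R)).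

Lemma intermediate_gt0 : \forall n \near \oo, (0 < k n)%N.
Proof. by move/cvgnyPgt : k_cvgy. Qed.

Lemma intermediate_mul_le M : \forall n \near \oo, (k n * M <= n)%N.
Proof.
have M0 : 0 < M.+1%:R^-1 :> R by rewrite invr_gt0.
near=> n.
have n0 : (0 < n)%N by near: n; exact: nbhs_infty_gt.
have : `|(k n)%:R / n%:R| < M.+1%:R^-1 :> R.
  by near: n; move/cvgr0_norm_lt : kn_cvg0; exact.
rewrite ger0_norm// ltr_pdivrMr ?ltr0n// mulrC ltr_pdivlMr ?ltr0n// -natrM ltr_nat.
by move=> /ltnW; apply: leq_trans; rewrite leq_mul2l leqnSn orbT.
Unshelve. all: by end_near. Qed.

Lemma intermediate_le : \forall n \near \oo, (k n <= n)%N.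
Proof. by have := intermediate_mul_le 1; under eq_near do rewrite muln1. Qed.

Lemma intermediate_divn : (n %/ k n)%N @[n --> \oo] --> \oo.
Proof.
apply/cvgnyPge => M; near=> n.
rewrite leq_divRL; last by near: n; exact: intermediate_gt0.
by rewrite mulnC; near: n; exact: intermediate_mul_le.
Unshelve. all: by end_near. Qed.

(** The level [b (n %/ k n)] is adapted to a sample of size [n %/ k n]; the rounding
    in this quotient is negligible. *)
Lemma intermediate_ratio :
  n%:R / ((k n)%:R * (n %/ k n)%N%:R) @[n --> \oo] --> (1 : R).
Proof.
apply/cvgrPdist_le => e e0.
have /cvgnyPgt := intermediate_divn => /(_ (Num.truncn e^-1).+1) He.
near=> n.
have k0 : (0 < k n)%N by near: n; exact: intermediate_gt0.
have me : (e^-1 < (n %/ k n)%N%:R).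
  apply: lt_le_trans (truncnS_gt _) _; rewrite ler_nat; apply: ltnW; by near: n.
have m0 : 0 < (n %/ k n)%N%:R :> R by apply: lt_trans me; rewrite invr_gt0.
have km0 : 0 < (k n)%:R * (n %/ k n)%N%:R :> R by rewrite mulr_gt0// ltr0n.
have nE : n%:R = (n %/ k n)%N%:R * (k n)%:R + (n %% k n)%N%:R :> R.
  by rewrite -natrM -natrD -divn_eq.
have mk : (n %% k n)%N%:R <= (k n)%:R :> R by rewrite ler_nat ltnW// ltn_pmod.
have -> : 1 - n%:R / ((k n)%:R * (n %/ k n)%N%:R) =
    - ((n %% k n)%N%:R / ((k n)%:R * (n %/ k n)%N%:R)) :> R.
  by rewrite {1}nE mulrDl (mulrC (n %/ k n)%N%:R) divff ?gt_eqF// opprD addNKr.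
rewrite normrN ger0_norm; last by rewrite divr_ge0 ?(ltW km0).
rewrite ler_pdivrMr//.
apply: le_trans mk _; rewrite mulrCA -[leLHS]mulr1 ler_wpM2l//.
by rewrite -ler_pdivrMl// mulr1 ltW.
Unshelve. all: by end_near. Qed.

End intermediate_sequence.

(** * Homogeneous measures *)

Lemma continuous_powR_gt0 (R : realType) (u x : R) : 0 < u ->
  v `^ x @[v --> u] --> u `^ x.
Proof.
move=> u0; suff : differentiable (fun v : R^o => v `^ x : R^o) u.
  by move=> /differentiable_continuous; exact.
apply/derivable1_diffP.
by apply: derivable_powR; rewrite in_itv/= andbT.
Qed.

Section homogeneous_measure.
Context (R : realType) (V : normedModType R) (alpha : R)
  (mu : {measure set (Borel V) -> \bar R}).
Hypotheses (mu_M0 : in_M0 mu)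
  (mu_hom : forall (t : R) (A : set (Borel V)), 0 < t -> measurable A ->
    mu [set t *: z | z in A] = ((t `^ (- alpha))%:E * mu A)%E).

Section superlevel.
Variable g : V -> R.
Hypotheses (g_cont : continuous g) (g_le : forall z, g z <= `|z|)
  (gZ : forall (t : R) z, 0 < t -> g (t *: z) = t * g z).

Let measurable_superlevel u :
  measurable ([set z | u <= g z] : set (Borel V)).
Proof. exact: measurable_superlevel_ge (continuous_Borel g_cont). Qed.

Lemma superlevel_bounded_away u : 0 < u -> bounded_away_from_0 [set z | u <= g z].
Proof. by move=> u0; apply: (bounded_away_ge u0) => z /= /le_trans; exact. Qed.

Lemma fin_num_superlevel u : 0 < u -> mu [set z | u <= g z] \is a fin_num.
Proof.
move=> u0; rewrite ge0_fin_numE//; apply: mu_M0.2.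
  exact: measurable_superlevel.
exact: superlevel_bounded_away.
Qed.

Lemma measure_superlevel u : 0 < u ->
  mu [set z | u <= g z] = ((u `^ (- alpha))%:E * mu [set z | (1 <= g z)%R])%E.
Proof.
move=> u0; rewrite -mu_hom//.
congr (mu _); apply/seteqP; split => [z /= uz|_ [z /= z1 <-] /=].
  exists (u^-1 *: z); last by rewrite scalerA divff ?gt_eqF// scale1r.
  by rewrite /= gZ ?invr_gt0// mulrC ler_pdivlMr// mul1r.
by rewrite gZ// ler_pMr.
Qed.

(** By homogeneity the measure of the superlevel set at [v] is a multiple of
    [v `^ (- alpha)], hence continuous in [v]; the level set at [u] sits between
    the superlevel sets at [u] and at any [v > u]. *)
Lemma measure_level u : 0 < u -> mu [set z | g z = u] = 0%E.
Proof.
move=> u0.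
have mL : measurable ([set z | g z = u] : set (Borel V)).
  exact: measurable_level.
have Lle : (mu [set z | g z = u] <= mu [set z | (u <= g z)%R])%E.
  by apply: le_measure; rewrite ?inE// => z /= ->.
have Lfin : mu [set z | g z = u] \is a fin_num.
  rewrite ge0_fin_numE//; apply: le_lt_trans Lle _.
  by rewrite ltey_eq fin_num_superlevel.
pose h v := v `^ (- alpha) * fine (mu [set z | 1 <= g z]).
have hE v : 0 < v -> mu [set z | v <= g z] = (h v)%:E.
  by move=> v0; rewrite measure_superlevel// EFinM fineK// fin_num_superlevel.
apply/eqP; rewrite eq_le measure_ge0 andbT -[leLHS]fineK// lee_fin.
have hu : h u - h v @[v --> u^'+] --> h u - h u.
  apply: cvgB; first exact: cvg_cst.
  apply: cvg_at_right_filter; apply: cvgM (cvg_cst _).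
  exact: continuous_powR_gt0.
rewrite subrr in hu; apply: (cvgr_to_ge hu); near=> v.
have uv : u < v by near: v; exact: nbhs_right_gt.
have v0 : 0 < v by exact: lt_trans uv.
rewrite lerBrDr -lee_fin EFinD fineK// -!hE// -measureU//.
- apply: le_measure; rewrite ?inE//; first exact: measurableU.
  by move=> z /= [->//|]; apply: le_trans; exact: ltW.
- by rewrite -subset0 => z /= [->]; rewrite leNgt uv.
Unshelve. all: by end_near. Qed.

End superlevel.

Lemma measure_norm_ge u : normalized mu -> 0 < u ->
  mu [set z | u <= `|z|] = (u `^ (- alpha))%:E.
Proof.
move=> mu1 u0.
have nZ (t : R) (z : V) : 0 < t -> `|t *: z| = t * `|z|.
  by move=> t0; rewrite normrZ gtr0_norm.
have nc : continuous (fun z : V => `|z|) by exact: norm_continuous.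
rewrite (@measure_superlevel (fun z => `|z|))// (_ : mu _ = 1%E) ?mule1//.
have -> : [set z : V | 1 <= `|z|] = [set z : V | `|z| = 1] `|` [set z | 1 < `|z|].
  apply/seteqP; split=> z /=; first by rewrite le_eqVlt => /orP[/eqP <-|]; [left|right].
  by case=> [->//|/ltW].
have null : mu [set z : V | `|z| = 1] = 0%E by exact: (@measure_level (fun z => `|z|)).
transitivity (mu [set z : V | (`|z| = 1)%R] + mu [set z : V | (1 < `|z|)%R])%E; last first.
  by rewrite null add0e.
apply: measureU.
- exact: measurable_level.
- exact: measurable_superlevel_gt (continuous_Borel nc).
- by rewrite -subset0 => z /= [->]; rewrite ltxx.
Qed.

End homogeneous_measure.

(** * Law of large numbers for the tail empirical measure *)

Section tail_empirical_measure.
Context (R : realType) (V : normedModType R) (d : measure_display)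
  (Omega : measurableType d) (P : probability Omega R) (Z : Omega -> V)
  (Zs : nat -> Omega -> V) (mu : {measure set (Borel V) -> \bar R})
  (b : nat -> R) (k : nat -> nat).
Hypotheses (Z_random : random_element Z) (mu_M0 : in_M0 mu)
  (Z_mu : M0_cvg
     (fun n A => (n%:R%:E * P [set w | A ((b n)^-1 *: Z w)])%E) mu)
  (Zs_copies : independent_copies P Z Zs)
  (k_cvgy : k n @[n --> \oo] --> \oo)
  (kn_cvg0 : (k n)%:R / n%:R @[n --> \oo] --> (0 : R)).

Lemma measurable_scale (a : R) (A : set (Borel V)) : measurable A ->
  measurable ([set z | A (a *: z)] : set (Borel V)).
Proof.
move=> mA; rewrite -[X in measurable X]setTI.
suff ma : measurable_fun setT ((fun z : V => a *: z) : Borel V -> Borel V).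
  exact: ma.
apply: (@measurability _ _ (Borel V) (Borel V) setT _ (@open V) erefl) => _ [U oU <-].
rewrite setTI; apply: open_Borel; apply: open_comp => // z _.
exact: scaler_continuous.
Qed.

Lemma measurable_scaled (a : R) (W : Omega -> V) (A : set (Borel V)) :
  random_element W -> measurable A -> measurable [set w | A (a *: W w)].
Proof.
move=> mW mA; have := mW measurableT _ (measurable_scale a mA).
by rewrite setTI.
Qed.

Section one_set.
Variable A : set (Borel V).
Hypotheses (mA : measurable A) (A_away : bounded_away_from_0 A)
  (A_bd : mu (boundary A) = 0%E).

Let p n : R := fine (P [set w | A ((b (n %/ k n)%N)^-1 *: Z w)]).

Lemma tail_mean_cvg : n%:R / (k n)%:R * p n @[n --> \oo] --> fine (mu A).
Proof.
have muA : mu A = (fine (mu A))%:E.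
  by rewrite fineK// ge0_fin_numE// mu_M0.2.
pose u m : R := fine (m%:R%:E * P [set w | A ((b m)^-1 *: Z w)])%E.
have u_cvg : u m @[m --> \oo] --> fine (mu A).
  by have := Z_mu mA A_away A_bd; rewrite {1}muA => /fine_cvg.
have divn_cvg := intermediate_divn k_cvgy kn_cvg0.
have um_cvg : u (n %/ k n)%N @[n --> \oo] --> fine (mu A).
  exact: (cvg_comp _ _ divn_cvg u_cvg).
have H : n%:R / ((k n)%:R * (n %/ k n)%N%:R) * u (n %/ k n)%N @[n --> \oo] -->
    1 * fine (mu A).
  by apply: cvgM um_cvg; exact: intermediate_ratio.
rewrite mul1r in H.
apply: cvg_trans H; apply: near_eq_cvg; near=> n.
have k0 : (k n)%:R != 0 :> R.
  by rewrite pnatr_eq0 -lt0n; near: n; exact: intermediate_gt0.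
have m0 : (n %/ k n)%N%:R != 0 :> R.
  rewrite pnatr_eq0 -lt0n; near: n.
  by move/cvgnyPgt : divn_cvg; exact.
rewrite /u fineM ?fin_num_measure//; last exact: measurable_scaled.
by rewrite /p /=; field; rewrite k0 m0.
Unshelve. all: by end_near. Qed.

(** The mean of the normalized count is given by [tail_mean_cvg], and its variance
    is at most this mean divided by [k n]. *)
Lemma tail_count_cvg :
  (k p.1)%:R^-1 * (\sum_(i < p.1) \1_A ((b (p.1 %/ k p.1)%N)^-1 *: Zs i p.2))
    @[p --> whp P] --> fine (mu A).
Proof.
case: Zs_copies => Zs_random Zs_law Zs_indep.
pose E n i := [set w | A ((b (n %/ k n)%N)^-1 *: Zs i w)].
have mE n i : measurable (E n i) by exact: measurable_scaled.
have mcA n : measurable ([set z | A ((b (n %/ k n)%N)^-1 *: z)] : set (Borel V)).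
  exact: measurable_scale.
have PE n i : P (E n i) = (p n)%:E.
  rewrite /p fineK; last by rewrite fin_num_measure//; exact: measurable_scaled.
  exact: (Zs_law i _ (mcA n)).
have PEI n i j : i != j -> P (E n i `&` E n j) = (p n * p n)%:E.
  move=> ij; have := Zs_indep [fset i; j]%fset (fun=> _) (fun=> mcA n).
  rewrite bigcap_fset big_fsetU1/= ?inE// !big_seq_fset1.
  rewrite big_fsetU1/= ?inE// big_seq_fset1 => H.
  by transitivity (P (E n i) * P (E n j))%E; [exact: H|rewrite !PE EFinM].
apply/cvgrPdist_le => e e0.
have e2 : 0 < e / 2 by rewrite divr_gt0.
pose F n := [set w | e / 2 * (k n)%:R <= `|\sum_(i < n) \1_(E n i) w - n%:R * p n|].
have mF n : measurable (F n).
  apply: measurable_superlevel_ge; apply: measurableT_comp => //.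
  apply: measurable_funB => //.
  by apply: measurable_sum => i; exact: measurable_indic.
have PF : P (F n) @[n --> \oo] --> 0%E.
  pose B n := n%:R * p n / (e / 2 * (k n)%:R) ^+ 2.
  have BE n : B n = n%:R / (k n)%:R * p n * ((k n)%:R^-1 * (e / 2) ^- 2).
    rewrite /B exprMn !invfM.
    by move: (k n)%:R^-1 (e^-1 / 2^-1) (p n) n%:R => y x u v; ring.
  have B0 : B n @[n --> \oo] --> 0.
    have kV : (k n)%:R^-1 @[n --> \oo] --> (0 : R).
      apply/(gtr0_cvgV0 (f := fun n => (k n)%:R)); last exact/cvgrnyP.
      by near=> n; rewrite ltr0n; near: n; exact: intermediate_gt0.
    under eq_fun do rewrite BE.
    rewrite -(mulr0 (fine (mu A))) -[X in _ * X](mul0r ((e / 2) ^- 2)).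
    apply: cvgM tail_mean_cvg _; apply: cvgM kV _; exact: cvg_cst.
  apply: (@squeeze_cvge _ _ _ _ (cst 0%E) _ (EFin \o B)); last 2 first.
  - exact: cvg_cst.
  - by apply: cvg_EFin; [exact: nearW|exact: B0].
  near=> n; rewrite measure_ge0/=; apply: count_chebyshev => //; first exact: PEI.
  rewrite mulr_gt0// ltr0n; near: n; exact: intermediate_gt0.
near=> q.
have nF : ~ F q.1 q.2 by near: q; exact: whp_event.
have k0 : 0 < (k q.1)%:R :> R.
  rewrite ltr0n; near: q; apply: (@whp_near _ _ _ _ [set n | 0 < k n]%N).
  exact: intermediate_gt0.
have mean : `|fine (mu A) - q.1%:R / (k q.1)%:R * p q.1| <= e / 2.
  near: q; apply: (@whp_near _ _ _ _ [set n | `|fine (mu A) - n%:R / (k n)%:R * p n| <= e / 2]).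
  by move/cvgrPdist_le : tail_mean_cvg; exact.
apply: le_trans (ler_distD (q.1%:R / (k q.1)%:R * p q.1) _ _) _.
rewrite [leRHS]splitr; apply: lerD => //.
rewrite distrC (_ : _ - _ = (k q.1)%:R^-1 * (\sum_(i < q.1) \1_(E q.1 i) q.2 - q.1%:R * p q.1)); last first.
  by rewrite mulrBr; congr (_ - _); ring.
rewrite normrM gtr0_norm ?invr_gt0// mulrC ler_pdivrMr// ltW//.
by rewrite ltNge; apply/negP.
Unshelve. all: by end_near. Qed.

End one_set.

End tail_empirical_measure.

(** * Second moment of a tail decaying fast along powers of two *)

Section dyadic_tail.
Context (R : realType) (d : measure_display) (T : measurableType d)
  (rho : {measure set T -> \bar R}) (r : T -> R).
Hypothesis r_meas : measurable_fun setT r.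
Variables (q t m : R).
Hypotheses (q_ge0 : 0 <= q) (q_lt1 : q < 1) (t_gt0 : 0 < t)
  (r_dyadic : forall s, t <= s ->
    (4%:E * rho [set x | (2 * s <= r x)%R] <= q%:E * rho [set x | (s <= r x)%R])%E)
  (r_fin : rho [set x | t <= r x] = m%:E).

Let B j := [set x | 2 ^+ j * t <= r x].

Let mB u : measurable [set x | u <= r x].
Proof. exact: measurable_superlevel_ge. Qed.

Let m_ge0 : 0 <= m.
Proof. by rewrite -lee_fin -r_fin. Qed.

Let measure_dyadic j : ((4 ^+ j)%:E * rho (B j) <= (q ^+ j * m)%:E)%E.
Proof.
elim: j => [|j ih].
  rewrite !expr0 mul1e mul1r -r_fin /B.
  by under eq_set do rewrite expr0 mul1r.
rewrite exprSr EFinM -muleA (_ : B j.+1 = [set x | 2 * (2 ^+ j * t) <= r x]); last first.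
  by rewrite /B; under eq_set do rewrite exprS -mulrA.
apply: (@le_trans _ _ ((4 ^+ j)%:E * (q%:E * rho (B j)))%E).
  rewrite lee_wpmul2l ?lee_fin ?exprn_ge0//; apply: r_dyadic.
  by apply: ler_peMl; [exact: ltW|rewrite exprn_ege1// ler1n].
rewrite muleCA exprS -mulrA [leRHS]EFinM lee_wpmul2l//.
Qed.

Let geometric_le n : \sum_(0 <= j < n) q ^+ j <= (1 - q)^-1.
Proof.
rewrite -[leRHS]mul1r ler_pdivlMr ?subr_gt0// mulrC -opprB mulNr.
rewrite big_mkord -subrX1 opprB lerBlDr lerDl exprn_ge0//.
Qed.

(** On the shell where [r] lies between [2 ^ j t] and [2 ^ (j + 1) t], the square
    of [r] is at most [4 ^ (j + 1) t ^ 2], while the measure of the shell is at most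
    [(q / 4) ^ j m]: the bounds form a geometric series. *)
Lemma dyadic_tail :
  (\int[rho]_(x in [set x | (t <= r x)%R]) (r x ^+ 2)%:E <=
   (4 * t ^+ 2 * m / (1 - q))%:E)%E.
Proof.
pose f j x := (4 ^+ j.+1 * t ^+ 2 * \1_(B j) x)%:E.
have f0 j x : (0 <= f j x)%E by rewrite lee_fin !mulr_ge0// ?exprn_ge0// ltW.
have mf j : measurable_fun [set x | t <= r x] (f j).
  apply/measurable_EFinP; apply: measurable_funM => //.
  exact: measurable_indic (mB _).
apply: (@le_trans _ _ (\int[rho]_(x in [set x | (t <= r x)%R]) (\sum_(j <oo) f j x))%E).
  apply: ge0_le_integral => //=.
  - by move=> x _; rewrite lee_fin sqr_ge0.
  - by apply/measurable_EFinP; apply: measurable_funX; exact: measurable_funTS.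
  - exact: ge0_emeasurable_sum.
  move=> x /= tx.
  have [j /andP[jx xj]] : exists j, (2 ^+ j * t <= r x) && (r x < 2 ^+ j.+1 * t).
    have ex : exists n, r x < 2 ^+ n * t.
      exists (Num.bound (r x / t)); rewrite -ltr_pdivrMr//.
      exact: upper_nthrootP.
    case: (ex_minnP ex) => -[|j] xj jmin.
      by move: xj; rewrite expr0 mul1r ltNge tx.
    exists j; rewrite xj andbT leNgt; apply/negP => /jmin.
    by rewrite ltnn.
  apply: (@le_trans _ _ (f j x)).
    have -> : f j x = ((2 ^+ j.+1 * t) ^+ 2)%:E.
      rewrite /f indicE mem_set// mulr1 exprMn -exprM mulnC exprM.
      by congr (_ ^+ _ * _)%:E; ring.
    have r0 : 0 < r x by exact: lt_le_trans tx.
    rewrite lee_fin ler_sqr ?nnegrE; first exact: ltW.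
      exact: ltW.
    exact: ltW (lt_trans r0 xj).
  apply: le_trans (nneseries_lim_ge j.+1 _); last first.
    by move=> i _ _; apply: f0.
  by rewrite big_nat_recr//= leeDr// sume_ge0.
rewrite integral_nneseries//; apply: lime_le.
  by apply: is_cvg_nneseries => i _ _; apply: integral_ge0 => x _; apply: f0.
apply: nearW => n.
apply: (@le_trans _ _ (\sum_(0 <= j < n) (4 * t ^+ 2 * m * q ^+ j)%:E)%E).
  apply: lee_sum => j _.
  have a0 : 0 <= 4 ^+ j.+1 * t ^+ 2 by rewrite mulr_ge0// exprn_ge0// ltW.
  rewrite /f; under eq_integral do rewrite EFinM.
  rewrite ge0_integralZl_EFin//; last first.
    by apply/measurable_EFinP; exact: measurable_indic (mB _).
  rewrite integral_indic//; last exact: mB.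
  apply: (@le_trans _ _ ((4 ^+ j.+1 * t ^+ 2)%:E * rho (B j))%E).
    rewrite lee_wpmul2l ?lee_fin//.
    by apply: le_measure; rewrite ?inE; [exact: measurableI (mB _) (mB _)|exact: mB|exact: subIsetl].
  have -> : 4 ^+ j.+1 * t ^+ 2 = 4 * t ^+ 2 * 4 ^+ j by rewrite exprS; ring.
  have -> : 4 * t ^+ 2 * m * q ^+ j = 4 * t ^+ 2 * (q ^+ j * m) by ring.
  rewrite EFinM [leRHS]EFinM -muleA lee_wpmul2l ?lee_fin ?mulr_ge0 ?(ltW t_gt0)//.
rewrite sumEFin lee_fin -mulr_sumr ler_wpM2l//.
by rewrite !mulr_ge0// ltW.
Qed.

End dyadic_tail.

(** The assumption only informs on [G] along multiples of [b n]. For a given large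
    [t], the integer [n] next above the inverse of [G t] satisfies [n G(t) ~ 1],
    which forces [t > u * b n] for any fixed [u < 1]; then
    [n G(2 t) <= n G(2 u * b n)], whose limit [(2 u) `^ (- alpha)] is below 1/4
    provided that [u] is close enough to 1. *)
Lemma regular_tail_dyadic (R : realType) (alpha : R) (b : nat -> R) (G : R -> R) :
  2 < alpha -> b n @[n --> \oo] --> +oo ->
  (forall t, 0 <= G t) -> {homo G : s t /~ s <= t} ->
  (forall u, 0 < u -> n%:R * G (u * b n) @[n --> \oo] --> u `^ (- alpha)) ->
  exists q t0, [/\ 0 <= q, q < 1, 0 < t0 &
    forall t, t0 <= t -> 4 * G (2 * t) <= q * G t].
Proof.
move=> alpha2 b_cvgy G0 G_noninc G_cvg.
have alpha0 : 0 < alpha by lra.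
(* With this exponent, [u = 2 ^ (a - 1)] lies below 1, and
   [(2 u) ^ (- alpha) = 2 ^ (- alpha / 2 - 1)] lies below 1/4, as [2 < alpha]. *)
pose a : R := 2^-1 + alpha^-1.
have aalpha : a * alpha = alpha / 2 + 1.
  by rewrite /a mulrDl mulVf ?gt_eqF// mulrC.
pose u : R := 2 `^ (a - 1).
have u0 : 0 < u by rewrite powR_gt0.
have u2E : 2 * u = 2 `^ a.
  by rewrite /u powRB; [rewrite powRr1//; field|rewrite pnatr_eq0 implybT].
pose s : R := alpha / 2 - 1.
have s_gt1 : 1 < 2 `^ s.
  have := @gt0_ltr_powR R s _ 1 2; rewrite powR1; apply; rewrite ?nnegrE//.
    by rewrite /s; lra.
  by rewrite ltr1n.
have one_lt : 1 < u `^ (- alpha).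
  rewrite /u -powRrM (_ : (a - 1) * - alpha = s)//.
  by rewrite mulrBl mul1r mulrN aalpha /s; lra.
have lt_quarter : (2 * u) `^ (- alpha) < 4^-1.
  rewrite u2E -powRrM (_ : a * - alpha = - (s + 2%:R)); last first.
    by rewrite mulrN aalpha /s; lra.
  rewrite powRN powRD; last by rewrite pnatr_eq0 implybT.
  rewrite powR_mulrn// ltf_pV2 ?posrE// ?mulr_gt0 ?powR_gt0 ?exprn_gt0//.
  by rewrite -[ltLHS]mul1r -natrX ltr_pM2r.
set q4 := ((2 * u) `^ (- alpha) + 4^-1) / 2.
pose dlt := (u `^ (- alpha) - 1) / 2.
have dlt0 : 0 < dlt by rewrite /dlt; lra.
have /cvgr_le/(_ q4) := G_cvg _ (mulr_gt0 (ltr0n R 2) u0); case; first by rewrite /q4; lra.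
move=> N1 _ HN1.
have /cvgr_gt/(_ (1 + dlt)) := G_cvg _ u0; case; first by rewrite /dlt; lra.
move=> N2 _ HN2.
pose N := maxn N1 N2.
have [t0 [t00 Gt0 GN]] : exists t0, [/\ 0 < t0, G t0 <= dlt & N.+1%:R * G t0 <= 1].
  pose e := Num.min dlt N.+1%:R^-1.
  have e0 : 0 < e by rewrite lt_min dlt0 invr_gt0 ltr0n.
  have /cvgr_lt/(_ 2) := G_cvg _ ltr01; rewrite powR1 => /(_ (ltr1n R 2)) H.
  near \oo => n.
  have bn : 0 < b n by near: n; move/cvgryPgt : b_cvgy; exact.
  have nG : n%:R * G (b n) < 2 by rewrite -[b n]mul1r; near: n.
  have ne : 2 / e < n%:R by near: n; have /cvgryPgt := @cvgr_idn R; exact.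
  have n0 : 0 < n%:R :> R by apply: le_lt_trans ne; rewrite divr_ge0// ltW.
  have Ge : G (b n) < e.
    rewrite ltr_pdivrMr// in ne; rewrite -(ltr_pM2l n0); exact: lt_trans nG ne.
  exists (b n); split => //.
    by apply: le_trans (ltW Ge) _; rewrite ge_min lexx.
  rewrite mulrC -ler_pdivlMr ?ltr0n// mul1r.
  by apply: le_trans (ltW Ge) _; rewrite ge_min lexx orbT.
exists (4 * q4), t0; split=> //.
- by rewrite mulr_ge0// divr_ge0// addr_ge0// powR_ge0.
- by rewrite /q4; lra.
move=> t t0t.
have GtN : N.+1%:R * G t <= 1.
  by apply: le_trans GN; rewrite ler_wpM2l//; exact: G_noninc.
have Gtd : G t <= dlt by apply: le_trans Gt0; exact: G_noninc.
have G2t : G (2 * t) <= G t by apply: G_noninc; lra.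
(* If [G] vanishes at [t], the integer [n] is not available, but [G] vanishes
   beyond [t] as well. *)
have [Gt0'|Gtneq] := eqVneq (G t) 0.
  have := G0 (2 * t); nra.
have Gtgt : 0 < G t by rewrite lt_def Gtneq G0.
pose n := (Num.truncn (G t)^-1).+1.
have n_gt : 1 < n%:R * G t.
  by rewrite -ltr_pdivrMr// mul1r truncnS_gt.
have n_le : n%:R * G t <= 1 + dlt.
  rewrite -natr1 mulrDl mul1r lerD//.
  rewrite -ler_pdivlMr// mul1r.
  by rewrite truncn_le ?invr_ge0.
have Nn : (N <= n)%N.
  rewrite /n leqW// truncn_ge_nat ?invr_ge0// -[leRHS]mul1r ler_pdivlMr//.
  by apply: le_trans GtN; rewrite ler_wpM2r// ler_nat.
have lt_t : u * b n < t.
  rewrite ltNge; apply/negP => tu; have := HN2 n; rewrite /=.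
  move=> /(_ (leq_trans (leq_maxr _ _) Nn)); apply/negP; rewrite -leNgt.
  apply: le_trans n_le; rewrite ler_wpM2l//; exact: G_noninc.
have Gle : n%:R * G (2 * t) <= q4.
  apply: le_trans (HN1 n (leq_trans (leq_maxl _ _) Nn)).
  by rewrite ler_wpM2l//; apply: G_noninc; lra.
have q40 : 0 <= q4 by rewrite divr_ge0// addr_ge0// powR_ge0.
rewrite -mulrA ler_pM2l//.
have n0 : 0 < n%:R :> R by rewrite ltr0n.
by rewrite -(ler_pM2l n0); nra.
Unshelve. all: by end_near. Qed.

(** * Elementary bounds on tails *)

Lemma powRN_gt1 (R : realType) (x a : R) : 0 < x < 1 -> 0 < a -> 1 < x `^ (- a).
Proof.
move=> /andP[x0 x1] a0; rewrite powRN invf_gt1 ?powR_gt0//.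
have := @gt0_ltr_powR _ a a0 x 1; rewrite powR1; apply; rewrite ?nnegrE//.
exact: ltW.
Qed.

Lemma powRN_lt1 (R : realType) (x a : R) : 1 < x -> 0 < a -> x `^ (- a) < 1.
Proof.
move=> x1 a0; have x0 : 0 < x by exact: lt_trans x1.
rewrite powRN invf_lt1 ?powR_gt0//.
have := @gt0_ltr_powR _ a a0 1 x; rewrite powR1; apply; rewrite ?nnegrE//.
exact: ltW.
Qed.

Lemma powR_tail_small (R : realType) (beta e : R) : 0 < beta -> 0 < e ->
  exists M0, 0 < M0 /\ forall M, M0 <= M -> M `^ (- beta) <= e.
Proof.
move=> beta0 e0; exists (e `^ (- beta^-1)); split; first by rewrite powR_gt0.
move=> M eM.
have M0 : 0 < M by apply: lt_le_trans eM; rewrite powR_gt0.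
rewrite powRN -[leRHS]invrK lef_pV2 ?posrE ?powR_gt0 ?invr_gt0//.
have -> : e^-1 = (e `^ (- beta^-1)) `^ beta.
  by rewrite -powRrM mulNr mulVf ?gt_eqF// powR_inv1// ltW.
by apply: ge0_ler_powR; rewrite ?nnegrE ?powR_ge0// ltW.
Qed.

Lemma markov_ge0 (R : realType) (d : measure_display) (T : measurableType d)
  (P : {measure set T -> \bar R}) (f : T -> R) (e : R) :
  measurable_fun setT f -> (forall x, 0 <= f x) -> 0 < e ->
  (e%:E * P [set x | e <= f x]%R <= \int[P]_x (f x)%:E)%E.
Proof.
move=> mf f0 e0.
have mE : measurable [set x | e <= f x] by exact: measurable_superlevel_ge.
rewrite -integral_cst//.
apply: (@le_trans _ _ (\int[P]_(x in [set x | (e <= f x)%R]) (f x)%:E)%E).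
  apply: ge0_le_integral => //=.
  - by move=> *; rewrite lee_fin ltW.
  - by apply/measurable_EFinP; exact: measurable_funTS.
apply: ge0_subset_integral => //=.
- by apply/measurable_EFinP.
- by move=> *; rewrite lee_fin.
Qed.

Lemma measurable_norm_tail (R : realType) (V : normedModType R)
  (d : measure_display) (T : measurableType d) (W : T -> V) (M : R) :
  measurable_fun setT (W : T -> Borel V) ->
  measurable_fun setT (fun w => `|W w| ^+ 2 * (M <= `|W w|)%R%:R).
Proof.
move=> mW.
have mn : measurable_fun setT (fun w => `|W w|).
  exact: measurableT_comp (continuous_Borel (@norm_continuous _ V)) mW.
have -> : (fun w => `|W w| ^+ 2 * (M <= `|W w|)%R%:R) =
    (fun w => `|W w| ^+ 2 * \1_[set w | M <= `|W w|] w).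
  by apply/funext => w; rewrite indic_pred.
apply: measurable_funM; first exact: measurable_funX.
by apply: measurable_indic; exact: measurable_superlevel_ge.
Qed.

Lemma integral_norm_tail (R : realType) (V : normedModType R)
  (d : measure_display) (T : measurableType d) (rho : {measure set T -> \bar R})
  (W : T -> V) (M : R) :
  (\int[rho]_w (`|W w| ^+ 2 * (M <= `|W w|)%R%:R)%:E =
   \int[rho]_(w in [set w | (M <= `|W w|)%R]) (`|W w| ^+ 2)%:E)%E.
Proof.
rewrite [RHS]integral_mkcond; apply: eq_integral => w _.
rewrite patchE; case: ifPn => [/set_mem/= ->|/negP wM]; first by rewrite mulr1.
have /negbTE -> : ~~ (M <= `|W w|) by apply/negP => Mr; apply: wM; rewrite inE.
by rewrite mulr0.
Qed.

(** * Averages of a functional over the tail of the sample *)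

(** By induction on the number of steps: either [x] is past the last step and the
    staircase is at the height of this step, or this step contributes nothing. *)
Lemma staircase_le (R : realType) (eta x : R) (J : nat) : 0 < eta -> 0 <= x ->
  0 <= x - eta * (\sum_(j < J) (j.+1%:R * eta <= x)%R%:R) /\
  (x < J.+1%:R * eta -> x - eta * (\sum_(j < J) (j.+1%:R * eta <= x)%R%:R) <= eta).
Proof.
move=> eta0 x0; elim: J => [|J [ih1 ih2]].
  by rewrite big_ord0 mulr0 subr0 mul1r; split=> // /ltW.
rewrite big_ord_recr/=; have [Jx|xJ] := leP (J.+1%:R * eta) x; last first.
  by rewrite mulr0n addr0; split=> // _; exact: ih2.
rewrite (eq_bigr (fun=> 1)); last first.
  move=> j _; rewrite (le_trans _ Jx)// ler_wpM2r ?(ltW eta0)// ler_nat.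
  by rewrite ltnS ltnW.
rewrite sumr_const card_ord -[_ *+ J]/(J%:R) natr1 mulrC; split.
  by rewrite subr_ge0.
by rewrite -[J.+2%:R]natr1 mulrDl mul1r => /ltW; rewrite lerBlDl.
Qed.

(** [W n i] stands for the [i]-th observation divided by the level of stage [n]. *)
Section functional_of_tail.
Context (R : realType) (V : normedModType R) (d : measure_display)
  (Omega : measurableType d) (P : probability Omega R)
  (mu : {measure set (Borel V) -> \bar R}) (k : nat -> nat)
  (W : nat -> nat -> Omega -> V).
Hypotheses (W_random : forall n i, random_element (W n i))
  (mu_M0 : in_M0 mu) (mu_normalized : normalized mu)
  (mu_unit : mu (boundary [set z | 1 < `|z|]) = 0%E)
  (W_count : forall A : set (Borel V), measurable A -> bounded_away_from_0 A ->
    mu (boundary A) = 0%E ->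
    (k p.1)%:R^-1 * (\sum_(i < p.1) \1_A (W p.1 i p.2)) @[p --> whp P] --> fine (mu A))
  (W_tail : forall e e' : R, 0 < e -> 0 < e' ->
    exists M0, 0 < M0 /\ forall M, M0 <= M -> \forall n \near \oo,
      (P [set w | (e <= (k n)%:R^-1 * (\sum_(i < n)
            `|W n i w| ^+ 2 * (M <= `|W n i w|)%R%:R))%R] <= e'%:E)%E)
  (mu_tail : forall e : R, 0 < e -> exists M0, 0 < M0 /\ forall M, M0 <= M ->
    (\int[mu]_(z in [set z | (M <= `|z|)%R]) (`|z| ^+ 2)%:E <= e%:E)%E).
Variable psi : V -> R.
Hypotheses (psi_meas : measurable_fun setT (psi : Borel V -> R))
  (psi_ge0 : forall z, 0 <= psi z) (psi_le : forall z, psi z <= `|z| ^+ 2)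
  (psi_away : forall z, `|z| <= 1 -> psi z = 0)
  (psi_boundary : forall a, 0 < a -> mu (boundary [set z | a <= psi z]) = 0%E).

Let mpsi u : measurable ([set z | u <= psi z] : set (Borel V)).
Proof. exact: measurable_superlevel_ge. Qed.

Let psi_gt u z : 0 < u -> u <= psi z -> 1 < `|z|.
Proof.
move=> u0 upsi; rewrite ltNge; apply/negP => /psi_away z0.
by move: upsi; rewrite z0 leNgt u0.
Qed.

Let psi_bounded_away u : 0 < u -> bounded_away_from_0 [set z | u <= psi z].
Proof.
by move=> u0; apply: (@bounded_away_ge _ _ 1) => // z /= /(psi_gt u0)/ltW.
Qed.

Let stairs eta J z := eta * (\sum_(j < J) (j.+1%:R * eta <= psi z)%R%:R).

(* The staircase misses at most [eta], and nothing at points where [psi] vanishes,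
   in particular in the unit ball; past its last step, [psi] and hence the norm
   are large. *)
Let psi_stairs eta J M z : 0 < eta -> 0 < M -> M ^+ 2 <= J.+1%:R * eta ->
  psi z - stairs eta J z <= eta * (1 < `|z|)%R%:R + `|z| ^+ 2 * (M <= `|z|)%R%:R.
Proof.
move=> eta0 M0 MJ; have [s_le s_close] := staircase_le J eta0 (psi_ge0 z).
have [zJ|Jz] := ltP (psi z) (J.+1%:R * eta).
  have [z1|z1] := ltP 1 `|z|.
    by rewrite mulr1 ler_wpDr ?s_close// mulr_ge0.
  apply: (@le_trans _ _ 0); last by rewrite mulr0 add0r mulr_ge0.
  rewrite subr_le0 psi_away// mulr_ge0 ?(ltW eta0)//.
  by apply: sumr_ge0.
have -> : M <= `|z|.
  by rewrite -ler_sqr ?nnegrE ?(ltW M0)// (le_trans MJ)// (le_trans Jz).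
rewrite mulr1 ler_wpDl ?mulr_ge0 ?(ltW eta0)// lerBlDr.
by rewrite (le_trans (psi_le z))// lerDl mulr_ge0 ?(ltW eta0)// sumr_ge0.
Qed.

Let stairs_indic eta J z :
  stairs eta J z = eta * (\sum_(j < J) \1_[set z | j.+1%:R * eta <= psi z] z).
Proof.
by rewrite /stairs; congr (_ * _); apply: eq_bigr => j _; rewrite indic_pred.
Qed.

Let stairs_measurable eta J : measurable_fun setT (stairs eta J : Borel V -> R).
Proof.
rewrite (funext (stairs_indic eta J)); apply: measurable_funM => //.
by apply: measurable_sum => j; apply: measurable_indic; exact: mpsi.
Qed.

Let stairs_ge0 eta J z : 0 < eta -> 0 <= stairs eta J z.
Proof. by move=> eta0; rewrite mulr_ge0 ?(ltW eta0)// sumr_ge0. Qed.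

Let stairs_integral eta J : 0 < eta ->
  (\int[mu]_z (stairs eta J z)%:E =
   (eta * (\sum_(j < J) fine (mu [set z | (j.+1%:R * eta <= psi z)%R])))%:E)%E.
Proof.
move=> eta0; under eq_integral do rewrite stairs_indic EFinM.
rewrite ge0_integralZl_EFin//; last 3 first.
- by move=> z _; rewrite lee_fin sumr_ge0.
- apply/measurable_EFinP; apply: measurable_sum => j.
  by apply: measurable_indic; exact: mpsi.
- exact: ltW.
rewrite EFinM; congr (_ * _)%E.
under eq_integral do rewrite -sumEFin.
rewrite ge0_integral_sum//; last first.
  by move=> j; apply/measurable_EFinP; apply: measurable_indic; exact: mpsi.
rewrite -sumEFin; apply: eq_bigr => j _.
rewrite integral_indic//.
rewrite setIT fineK// ge0_fin_numE//; apply: mu_M0.2; first exact: mpsi.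
by apply: psi_bounded_away; rewrite mulr_gt0.
Qed.

Let psi_integral eta J M (e : R) : 0 < eta -> 0 < M -> M ^+ 2 <= J.+1%:R * eta ->
  (\int[mu]_(z in [set z | (M <= `|z|)%R]) (`|z| ^+ 2)%:E <= e%:E)%E ->
  (\int[mu]_z (stairs eta J z)%:E <= \int[mu]_z (psi z)%:E <=
   \int[mu]_z (stairs eta J z)%:E + (eta + e)%:E)%E.
Proof.
move=> eta0 M0 MJ tail_le; apply/andP; split.
  apply: ge0_le_integral => //=.
  - by move=> z _; rewrite lee_fin stairs_ge0.
  - by apply/measurable_EFinP; exact: stairs_measurable.
  - by apply/measurable_EFinP.
  - move=> z _; rewrite lee_fin -subr_ge0.
    by have [] := staircase_le J eta0 (psi_ge0 z).
pose unit z : R := eta * \1_[set z : V | 1 < `|z|] z.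
pose tail z : R := `|z : V| ^+ 2 * (M <= `|z|)%R%:R.
have mnorm : measurable_fun setT ((fun z : V => `|z|) : Borel V -> R).
  exact: continuous_Borel (@norm_continuous _ V).
have m1 : measurable ([set z : V | 1 < `|z|] : set (Borel V)).
  exact: measurable_superlevel_gt.
have munit : measurable_fun setT (unit : Borel V -> R).
  by apply: measurable_funM => //; exact: measurable_indic.
have mtail : measurable_fun setT (tail : Borel V -> R).
  exact: (@measurable_norm_tail R V _ (Borel V) (fun z => z) M (@measurable_id _ (Borel V) setT)).
have unit0 z : 0 <= unit z by rewrite mulr_ge0 ?(ltW eta0).
have tail0 z : 0 <= tail z by rewrite mulr_ge0.
apply: (@le_trans _ _ (\int[mu]_z ((stairs eta J z)%:E + ((unit z)%:E + (tail z)%:E)))%E).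
  apply: ge0_le_integral => //=.
  - by move=> z _; rewrite lee_fin.
  - by apply/measurable_EFinP.
  - apply: emeasurable_funD; first by apply/measurable_EFinP; exact: stairs_measurable.
    by apply: emeasurable_funD; exact/measurable_EFinP.
  - move=> z _; rewrite -!EFinD lee_fin -lerBlDl.
    by rewrite /unit indic_pred; exact: psi_stairs.
rewrite ge0_integralD//; last 4 first.
- by move=> z _; rewrite lee_fin stairs_ge0.
- by apply/measurable_EFinP; exact: stairs_measurable.
- by move=> z _; rewrite adde_ge0// lee_fin.
- by apply: emeasurable_funD; exact/measurable_EFinP.
rewrite leeD2l// ge0_integralD//; last 4 first.
- by move=> z _; rewrite lee_fin.
- exact/measurable_EFinP.
- by move=> z _; rewrite lee_fin.
- exact/measurable_EFinP.
rewrite EFinD leeD//.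
  rewrite /unit; under eq_integral do rewrite EFinM.
  rewrite ge0_integralZl_EFin//; last 2 first.
  - by apply/measurable_EFinP; exact: measurable_indic.
  - exact: ltW.
  by rewrite integral_indic// setIT (_ : mu _ = 1%E)// mule1.
by rewrite /tail (@integral_norm_tail _ V _ (Borel V) mu idfun).
Qed.

Let stairs_cvg eta J : 0 < eta ->
  (k p.1)%:R^-1 * (\sum_(i < p.1) stairs eta J (W p.1 i p.2)) @[p --> whp P] -->
  eta * (\sum_(j < J) fine (mu [set z | (j.+1%:R * eta <= psi z)%R])).
Proof.
move=> eta0.
rewrite [X in X @ _ --> _](_ : _ = fun p => eta * (\sum_(j < J) (k p.1)%:R^-1 *
      (\sum_(i < p.1) \1_[set z | j.+1%:R * eta <= psi z] (W p.1 i p.2)))).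
  apply: cvgM; first exact: cvg_cst.
  apply: cvg_big => [|j _]; [exact: add_continuous|].
  have j0 : 0 < j.+1%:R * eta by rewrite mulr_gt0.
  by apply: W_count; [exact: mpsi|exact: psi_bounded_away|exact: psi_boundary].
apply/funext => -[n w] /=; under eq_bigr do rewrite stairs_indic.
by rewrite -!mulr_sumr mulrCA exchange_big.
Qed.

Lemma tail_functional_integrable : mu.-integrable setT (EFin \o psi).
Proof.
have [M [M0 /(_ M (lexx _)) HM]] := mu_tail (ltr01 : 0 < 1 :> R).
pose J := Num.bound (M ^+ 2).
have MJ : M ^+ 2 <= J.+1%:R * 1.
  rewrite mulr1; apply: le_trans (ltW (archi_boundP (sqr_ge0 M))) _.
  by rewrite ler_nat.
have := psi_integral ltr01 M0 MJ HM; rewrite stairs_integral// => /andP[_ psi_fin].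
apply/integrableP; split; first exact/measurable_EFinP.
under eq_integral do rewrite /= ger0_norm//.
by apply: le_lt_trans psi_fin _; rewrite -EFinD ltry.
Qed.

(** The staircase is a finite combination of indicators of continuity sets, whose
    averages converge by [W_count]. The step [e / 4] and the level [M] are chosen so
    that each of the two error terms of [psi_stairs] contributes at most [e / 2],
    the average number of points beyond the unit sphere being eventually at
    most 2. *)
Lemma sample_functional_cvg :
  (k p.1)%:R^-1 * (\sum_(i < p.1) psi (W p.1 i p.2)) @[p --> whp P] -->
  \int[mu]_z psi z.
Proof.
apply: (@whp_cvg_approx _ _ _ P
  (fun n w => (k n)%:R^-1 * (\sum_(i < n) psi (W n i w)))) => e e' e0 e'0.
have e2 : 0 < e / 2 by rewrite divr_gt0.
have eta0 : 0 < e / 4 by rewrite divr_gt0.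
have [M1 [M10 HM1]] := W_tail e2 e'0.
have [M2 [M20 HM2]] := mu_tail e2.
pose M := Num.max M1 M2.
have M0 : 0 < M by rewrite lt_max M10.
pose J := Num.bound (M ^+ 2 / (e / 4)).
have MJ : M ^+ 2 <= J.+1%:R * (e / 4).
  rewrite -ler_pdivrMr//; apply: le_trans (ltW (archi_boundP _)) _.
    by rewrite divr_ge0 ?sqr_ge0// ltW.
  by rewrite ler_nat.
exists (fun n w => (k n)%:R^-1 * (\sum_(i < n) stairs (e / 4) J (W n i w))).
exists (e / 4 * (\sum_(j < J) fine (mu [set z | (j.+1%:R * (e / 4) <= psi z)%R]))).
exists (fun n => [set w | (e / 2 <= (k n)%:R^-1 * (\sum_(i < n)
            `|W n i w| ^+ 2 * (M <= `|W n i w|)%R%:R))%R]).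
split.
- exact: stairs_cvg.
- have M2M : M2 <= M by rewrite le_max lexx orbT.
  have := psi_integral eta0 M0 MJ (HM2 _ M2M); rewrite stairs_integral//.
  rewrite /Rintegral.
  case: (\int[mu]_z (psi z)%:E)%E => [x|/andP[_]|/andP[]] /=;
    [|by rewrite -EFinD leye_eq|by rewrite leeNy_eq].
  rewrite -EFinD !lee_fin => /andP[sx xs].
  by rewrite ger0_norm ?subr_ge0// lerBlDl (le_trans xs)// lerD2l; lra.
- move=> n; apply: measurable_superlevel_ge; apply: measurable_funM => //.
  by apply: measurable_sum => i; exact: measurable_norm_tail (W_random n i).
- by apply: HM1; rewrite le_max lexx.
have unit_away : bounded_away_from_0 [set z : V | 1 < `|z|].
  by apply: (@bounded_away_ge _ _ 1) => // z /= /ltW.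
have m1 : measurable ([set z : V | 1 < `|z|] : set (Borel V)).
  exact: measurable_superlevel_gt (continuous_Borel (@norm_continuous _ V)).
have := W_count m1 unit_away mu_unit; rewrite mu_normalized /= => N_cvg.
near=> p => tail.
have {}tail : (k p.1)%:R^-1 * (\sum_(i < p.1)
    `|W p.1 i p.2| ^+ 2 * (M <= `|W p.1 i p.2|)%R%:R) < e / 2.
  by rewrite ltNge; apply/negP.
have N2 : (k p.1)%:R^-1 * (\sum_(i < p.1) \1_[set z : V | 1 < `|z|] (W p.1 i p.2)) < 2 :> R.
  by near: p; apply: (cvgr_lt _ N_cvg); rewrite ltr1n.
rewrite -mulrBr -sumrB normrM ger0_norm//.
apply: (@le_trans _ _ ((k p.1)%:R^-1 * (\sum_(i < p.1)
   (e / 4 * (1 < `|W p.1 i p.2|)%R%:R + `|W p.1 i p.2| ^+ 2 * (M <= `|W p.1 i p.2|)%R%:R)))).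
  rewrite ler_wpM2l// (le_trans (ler_norm_sum _ _ _))//; apply: ler_sum => i _.
  rewrite ger0_norm; first exact: psi_stairs.
  by have [] := staircase_le J eta0 (psi_ge0 (W p.1 i p.2)).
rewrite big_split/= mulrDr -mulr_sumr mulrCA.
have -> : \sum_(i < p.1) (1 < `|W p.1 i p.2|)%R%:R =
    \sum_(i < p.1) \1_[set z : V | 1 < `|z|] (W p.1 i p.2) :> R.
  by apply: eq_bigr => i _; rewrite indic_pred.
move: N2 tail; set N := _ * _; set B := _ * _; nra.
Unshelve. all: by end_near. Qed.

End functional_of_tail.

(** * Order statistics *)

Section kth_largest_theory.
Context (R : realType).

Lemma kth_largest_ge (r : nat -> R) (n k : nat) (u : R) : (0 < k <= n)%N ->
  (u <= kth_largest r n k) = (k%:R <= \sum_(i < n) (u <= r i)%R%:R :> R).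
Proof.
move=> /andP[k0 kn]; set l := [seq r i | i <- iota 0 n].
have -> : \sum_(i < n) (u <= r i)%R%:R = (count (fun x => u <= x) l)%:R :> R.
  rewrite /l count_map -sum1_count natr_sum -(big_mkord xpredT (fun i => (u <= r i)%R%:R)).
  rewrite /index_iota subn0 [RHS]big_mkcond/=; apply: eq_bigr => i _.
  by case: (u <= r i).
rewrite ler_nat /kth_largest -/l -(permP (permEl (perm_sort >=%R l))).
have : sorted >=%R (sort >=%R l) by apply: sort_sorted => x y; exact: ge_total.
have : size (sort >=%R l) = n by rewrite size_sort size_map size_iota.
move: (sort _ _) => s sn s_sorted.
have s_nth i j : (i <= j)%N -> (j < n)%N -> nth 0 s j <= nth 0 s i.
  move=> ij jn; apply: (sorted_leq_nth _ _ 0 s_sorted) => //.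
  - by move=> x y z yx zy; exact: le_trans zy yx.
  - by move=> x; exact: lexx.
  - by rewrite inE sn (leq_ltn_trans ij).
  - by rewrite inE sn.
have kn' : (k.-1 < n)%N by rewrite prednK.
apply/idP/idP => [us|].
  rewrite -(cat_take_drop k s) count_cat; apply: leq_trans (leq_addr _ _).
  rewrite -[leqLHS](_ : size (take k s) = k); last by rewrite size_takel// sn.
  rewrite leq_eqVlt; apply/orP; left; rewrite eq_sym -all_count.
  apply/(all_nthP 0) => i; rewrite size_takel ?sn// => ik.
  rewrite nth_take// (le_trans us)// s_nth// -ltnS prednK//.
apply: contraTT; rewrite -ltNge -ltnNge => su.
rewrite -(cat_take_drop k.-1 s) count_cat.
rewrite [X in (_ + X)%N](_ : _ = 0)%N ?addn0; last first.
  apply/eqP; rewrite -leqn0 leqNgt -has_count; apply/negP => /(has_nthP 0)[i].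
  rewrite size_drop sn ltn_subRL => ik; rewrite nth_drop leNgt => /negP; apply.
  by apply: le_lt_trans su; apply: s_nth => //; exact: leq_addr.
rewrite (leq_ltn_trans (count_size _ _))// size_takel ?sn ?(ltnW kn')//.
by rewrite prednK.
Qed.

(** At ranks outside the range from 1 to [n] the function is the constant 0, except
    that rank 0 is the same as rank 1, by the convention [0.-1 = 0]. *)
Lemma measurable_kth_largest (d : measure_display) (T : measurableType d)
  (r : nat -> T -> R) (n k : nat) : (forall i, measurable_fun setT (r i)) ->
  measurable_fun setT (fun w => kth_largest (fun i => r i w) n k).
Proof.
move=> mr; have [nk|kn] := leqP n k.-1.
  rewrite (_ : (fun _ => _) = cst 0)//; apply/funext => w.
  by rewrite /kth_largest nth_default// size_sort size_map size_iota.
have -> : (fun w => kth_largest (fun i => r i w) n k) =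
    (fun w => kth_largest (fun i => r i w) n k.-1.+1) by [].
apply: (measurability _ (RGenCInfty.measurableE R)) => _ [_ [u ->] <-].
rewrite setTI.
rewrite (_ : _ @^-1` _ = [set w | k.-1.+1%:R <= \sum_(i < n) \1_[set w | u <= r i w] w :> R]).
  apply: measurable_superlevel_ge; apply: measurable_sum => i.
  by apply: measurable_indic; exact: measurable_superlevel_ge.
apply/seteqP; split=> w /=; under eq_bigr do rewrite indic_pred;
  by rewrite in_itv/= andbT kth_largest_ge.
Qed.

End kth_largest_theory.

(** * Quadratic functionals beyond the unit sphere *)

Section quadratic_functional.
Context (R : realType) (V : normedModType R) (alpha : R)
  (mu : {measure set (Borel V) -> \bar R}) (phi : V -> R).
Hypotheses (mu_M0 : in_M0 mu)
  (mu_hom : forall (t : R) (A : set (Borel V)), 0 < t -> measurable A ->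
    mu [set t *: z | z in A] = ((t `^ (- alpha))%:E * mu A)%E)
  (phi_cont : continuous phi) (phi_le : forall z, `|phi z| <= `|z| ^+ 2)
  (phiZ : forall t z, phi (t *: z) = t ^+ 2 * phi z).

(** The square root of the positive part of [phi] is homogeneous of degree 1, which
    puts [measure_level] within reach. *)
Lemma quadratic_level_null a : 0 < a -> mu [set z | phi z = a] = 0%E.
Proof.
move=> a0; pose g z := Num.sqrt (phi z).
rewrite (_ : [set z | phi z = a] = [set z | g z = Num.sqrt a]).
  apply: (measure_level mu_M0 mu_hom) => [z|z|t z t0|]; last by rewrite sqrtr_gt0.
  - by apply: continuous_comp; [exact: phi_cont|exact: sqrt_continuous].
  - rewrite /g -[leRHS]ger0_norm// -sqrtr_sqr ler_wsqrtr//.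
    by rewrite (le_trans (ler_norm _)).
  - by rewrite /g phiZ sqrtrM ?sqr_ge0// sqrtr_sqr gtr0_norm.
apply/seteqP; split=> z /=; rewrite /g; first by move=> ->.
have [z0|z0] := leP 0 (phi z); first by move=> /eqP; rewrite eqr_sqrt ?(ltW a0)// => /eqP.
by rewrite ltr0_sqrtr// => /esym/eqP; rewrite gt_eqF// sqrtr_gt0.
Qed.

Lemma norm_level_null u : 0 < u -> mu [set z | `|z| = u] = 0%E.
Proof.
move=> u0; apply: (@measure_level _ _ alpha _ _ _ (fun z => `|z|)) => //.
  exact: norm_continuous.
by move=> t z t0; rewrite normrZ gtr0_norm.
Qed.

Lemma unit_boundary_null : mu (boundary [set z : V | 1 < `|z|]) = 0%E.
Proof.
apply: (@boundary_null _ _ _ _ [set z | `|z| = 1]).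
- by apply: measurable_level; exact: norm_continuous.
- exact: norm_level_null.
- by apply: (boundary_superlevel (@norm_continuous _ V)) => z //= /ltW.
Qed.

(** Staircase approximation is for nonnegative functions: [phi] is split as the
    difference of this part for [phi] and for its opposite. *)
Definition tail_positive_part z : R := Num.max (phi z) 0 * (1 < `|z|)%R%:R.

Lemma tail_positive_part_boundary a : 0 < a ->
  mu (boundary [set z | a <= tail_positive_part z]) = 0%E.
Proof.
move=> a0.
have -> : [set z | a <= tail_positive_part z] =
    [set z | a <= phi z] `&` [set z | 1 < `|z|].
  apply/seteqP; split=> z /=; rewrite /tail_positive_part.
    case: ltP => z1; last by rewrite mulr0 leNgt a0.
    by rewrite mulr1 le_max => /orP[//|]; rewrite leNgt a0.
  by move=> [az ->]; rewrite mulr1 le_max az.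
have mphi : measurable ([set z | phi z = a] : set (Borel V)).
  exact: measurable_level.
have mnorm : measurable ([set z : V | `|z| = 1] : set (Borel V)).
  by apply: measurable_level; exact: norm_continuous.
apply: (@boundary_null _ _ _ _ ([set z | phi z = a] `|` [set z | `|z| = 1])).
- exact: measurableU.
- apply/eqP; rewrite eq_le measure_ge0 andbT.
  apply: (@le_trans _ _ (mu [set z | (phi z = a)%R] + mu [set z | (`|z : V| = 1)%R])%E).
    exact: measureU2.
  by rewrite quadratic_level_null// norm_level_null// adde0.
apply: subset_trans (@boundaryI _ _ _ _) _; apply: setUSS.
  by apply: (boundary_superlevel phi_cont) => z //= /ltW.
by apply: (boundary_superlevel (@norm_continuous _ V)) => z //= /ltW.
Qed.

Lemma tail_positive_part_measurable :
  measurable_fun setT (tail_positive_part : Borel V -> R).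
Proof.
apply: measurable_funM.
  by apply: measurable_maxr => //; exact: continuous_Borel.
rewrite (_ : (fun z : Borel V => (1 < `|z : V|)%R%:R) = \1_[set z : V | 1 < `|z|]).
  apply: measurable_indic; apply: measurable_superlevel_gt.
  exact: continuous_Borel (@norm_continuous _ V).
by apply/funext => z; rewrite indic_pred.
Qed.

Lemma tail_positive_part_ge0 z : 0 <= tail_positive_part z.
Proof. by rewrite mulr_ge0// le_max lexx orbT. Qed.

Lemma tail_positive_part_le z : tail_positive_part z <= `|z| ^+ 2.
Proof.
rewrite /tail_positive_part; case: (1 < _); rewrite ?mulr1 ?mulr0//.
by rewrite ge_max sqr_ge0 andbT (le_trans (ler_norm _)).
Qed.

Lemma tail_positive_part_away z : `|z| <= 1 -> tail_positive_part z = 0.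
Proof. by rewrite /tail_positive_part leNgt => /negbTE ->; rewrite mulr0. Qed.

End quadratic_functional.

Lemma tail_positive_partB (R : realType) (V : normedModType R) (phi : V -> R) z :
  tail_positive_part phi z - tail_positive_part (fun z => - phi z) z =
  phi z * (1 < `|z|)%R%:R.
Proof.
rewrite /tail_positive_part -mulrBl; congr (_ * _).
have [p0|p0] := leP (phi z) 0.
  by rewrite max_l ?oppr_ge0// sub0r opprK.
by rewrite max_r ?subr0// oppr_le0 ltW.
Qed.

(** * The sample beyond a random threshold *)

Section random_threshold.
Context (R : realType) (V : normedModType R) (d : measure_display)
  (Omega : measurableType d) (P : probability Omega R) (Z : Omega -> V)
  (Zs : nat -> Omega -> V) (alpha : R) (mu : {measure set (Borel V) -> \bar R})
  (b : nat -> R) (k : nat -> nat).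
Hypotheses (alpha_gt2 : 2 < alpha)
  (Z_random : random_element Z) (mu_M0 : in_M0 mu)
  (mu_hom : forall (t : R) (A : set (Borel V)), 0 < t -> measurable A ->
    mu [set t *: z | z in A] = ((t `^ (- alpha))%:E * mu A)%E)
  (mu_normalized : normalized mu)
  (b_cvgy : b n @[n --> \oo] --> +oo)
  (Z_mu : M0_cvg
     (fun n A => (n%:R%:E * P [set w | A ((b n)^-1 *: Z w)])%E) mu)
  (Zs_copies : independent_copies P Z Zs)
  (k_cvgy : k n @[n --> \oo] --> \oo)
  (kn_cvg0 : (k n)%:R / n%:R @[n --> \oo] --> (0 : R)).

Let nZ (t : R) (z : V) : 0 < t -> `|t *: z| = t * `|z|.
Proof. by move=> t0; rewrite normrZ gtr0_norm. Qed.

Let nc : continuous (fun z : V => `|z|) := @norm_continuous _ _.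

Lemma measurable_norm_ge u : measurable ([set z | u <= `|z|] : set (Borel V)).
Proof. exact: measurable_superlevel_ge (continuous_Borel nc). Qed.

Lemma norm_ge_boundary_null u : 0 < u -> mu (boundary [set z | u <= `|z|]) = 0%E.
Proof.
move=> u0; apply: (@boundary_null _ _ _ _ [set z | `|z| = u]).
- exact: measurable_level.
- exact: (norm_level_null mu_M0 mu_hom).
- by apply: (boundary_superlevel nc) => z //= /ltW.
Qed.

Lemma norm_ge_away u : 0 < u -> bounded_away_from_0 [set z : V | u <= `|z|].
Proof. by move=> u0; exact: (bounded_away_ge u0). Qed.

(** Karamata's bound in the form used by [dyadic_tail]: a doubled threshold is at
    most [q / 4] times as likely to be exceeded. *)
Lemma norm_tail_dyadic : exists q t0, [/\ 0 <= q, q < 1, 0 < t0 &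
  forall t, t0 <= t ->
  (4%:E * P [set w | (2 * t <= `|Z w|)%R] <= q%:E * P [set w | (t <= `|Z w|)%R])%E].
Proof.
pose G t : R := fine (P [set w | t <= `|Z w|]).
have mG t : measurable [set w | t <= `|Z w|].
  by have := Z_random measurableT (measurable_norm_ge t); rewrite setTI.
have PG t : P [set w | t <= `|Z w|] = (G t)%:E.
  by rewrite fineK// fin_num_measure.
have [q [t0 [q0 q1 t00 Gq]]] : exists q t0, [/\ 0 <= q, q < 1, 0 < t0 &
    forall t, t0 <= t -> 4 * G (2 * t) <= q * G t].
  apply: (regular_tail_dyadic alpha_gt2 b_cvgy).
  - by move=> t; exact: fine_ge0.
  - move=> s t st; rewrite -lee_fin -!PG; apply: le_measure; rewrite ?inE//.
    by move=> w /=; exact: le_trans.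
  - move=> u u0.
    have := Z_mu (measurable_norm_ge u) (norm_ge_away u0) (norm_ge_boundary_null u0).
    rewrite (measure_norm_ge mu_M0 mu_hom)// => /fine_cvg H; apply: cvg_trans H.
    apply: near_eq_cvg; near=> n => /=.
    have bn : 0 < b n by near: n; move/cvgryPgt : b_cvgy; exact.
    rewrite (_ : [set w | _] = [set w | u * b n <= `|Z w|]); first by rewrite PG.
    apply/seteqP; split => w /=; rewrite nZ ?invr_gt0//.
      by rewrite mulrC ler_pdivlMr.
    by rewrite [X in _ -> is_true (_ <= X)]mulrC ler_pdivlMr.
exists q, t0; split=> // t /Gq.
by rewrite !PG -!EFinM lee_fin.
Unshelve. all: by end_near. Qed.

Let dyadic_ratio_lt1 : 2 `^ (2 - alpha) < 1 :> R.
Proof. by rewrite -(opprB alpha); apply: powRN_lt1; rewrite ?subr_gt0 ?ltr1n. Qed.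

Lemma mu_tail_le M : 0 < M ->
  (\int[mu]_(z in [set z | (M <= `|z|)%R]) (`|z| ^+ 2)%:E <=
   (4 / (1 - 2 `^ (2 - alpha)) * M `^ (- (alpha - 2)))%:E)%E.
Proof.
move=> M0.
have mu_dyadic s : M <= s ->
    (4%:E * mu [set z | (2 * s <= `|z|)%R] <=
     (2 `^ (2 - alpha))%:E * mu [set z | (s <= `|z|)%R])%E.
  move=> Ms; have s0 : 0 < s by exact: lt_le_trans Ms.
  rewrite !(measure_norm_ge mu_M0 mu_hom)// ?mulr_gt0// -!EFinM lee_fin.
  rewrite powRM ?(ltW s0)// mulrA ler_wpM2r ?powR_ge0//.
  rewrite powRD ?pnatr_eq0 ?implybT// powR_mulrn// le_eqVlt; apply/orP; left.
  by apply/eqP; ring.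
have := dyadic_tail (continuous_Borel nc) (powR_ge0 2 (2 - alpha)) dyadic_ratio_lt1 M0 mu_dyadic
  (measure_norm_ge mu_M0 mu_hom mu_normalized M0).
move=> /le_trans; apply.
rewrite lee_fin le_eqVlt; apply/orP; left; apply/eqP.
have -> : M `^ (- (alpha - 2)) = M ^+ 2 * M `^ (- alpha).
  by rewrite opprB powRD ?(gt_eqF M0) ?implybT// -powR_mulrn// ltW.
by rewrite mulrAC; ring.
Qed.

Lemma mu_tail_small (e : R) : 0 < e ->
  exists M0, 0 < M0 /\ forall M, M0 <= M ->
    (\int[mu]_(z in [set z | (M <= `|z|)%R]) (`|z| ^+ 2)%:E <= e%:E)%E.
Proof.
move=> e0; have b0 : 0 < alpha - 2 by rewrite subr_gt0.
pose C : R := 4 / (1 - 2 `^ (2 - alpha)).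
have C0 : 0 < C by rewrite divr_gt0// subr_gt0.
have [M0 [M00 HM0]] := powR_tail_small b0 (divr_gt0 e0 C0).
exists M0; split=> // M MM0; have Mgt0 : 0 < M by exact: lt_le_trans MM0.
apply: le_trans (mu_tail_le Mgt0) _; rewrite lee_fin mulrC -ler_pdivlMr//.
exact: HM0.
Qed.

(** Markov's inequality and [dyadic_tail] bound this probability by a constant times
    [M ^ 2] times the normalized mean number of points beyond [M], which tends to
    [M `^ (- alpha)]: the limit is of order [M `^ (2 - alpha)], small for large
    [M]. *)
Lemma sample_tail_small (e e' : R) : 0 < e -> 0 < e' ->
  exists M0, 0 < M0 /\ forall M, M0 <= M -> \forall n \near \oo,
    (P [set w | (e <= (k n)%:R^-1 * (\sum_(i < n)
          `|(b (n %/ k n)%N)^-1 *: Zs i w| ^+ 2 *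
          (M <= `|(b (n %/ k n)%N)^-1 *: Zs i w|)%R%:R))%R] <= e'%:E)%E.
Proof.
move=> e0 e'0; have [Zs_random Zs_law _] := Zs_copies.
have [q [t0 [q0 q1 t00 Gq]]] := norm_tail_dyadic.
(* [C] is made opaque to keep unification from unfolding it. *)
have [C CE] : exists C, C = 4 / (1 - q) / e by eexists.
have C0 : 0 < C by rewrite CE; apply: divr_gt0 => //; apply: divr_gt0; rewrite ?subr_gt0.
have b0 : 0 < alpha - 2 by rewrite subr_gt0.
have [M0 [M00 HM0]] := powR_tail_small b0 (divr_gt0 e'0 (mulr_gt0 (ltr0n R 2) C0)).
exists M0; split=> // M MM0.
have Mgt0 : 0 < M by exact: lt_le_trans MM0.
pose p n : R := fine (P [set w | M <= `|(b (n %/ k n)%N)^-1 *: Z w|]).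
have p_cvg : C * M ^+ 2 * (n%:R / (k n)%:R * p n) @[n --> \oo] -->
    C * M ^+ 2 * M `^ (- alpha).
  apply: cvgM; first exact: cvg_cst.
  have := tail_mean_cvg Z_random mu_M0 Z_mu k_cvgy kn_cvg0 (measurable_norm_ge M)
    (norm_ge_away Mgt0) (norm_ge_boundary_null Mgt0).
  by rewrite (measure_norm_ge mu_M0 mu_hom).
have lim_lt : C * M ^+ 2 * M `^ (- alpha) < e'.
  have -> : C * M ^+ 2 * M `^ (- alpha) = C * M `^ (- (alpha - 2)).
    by rewrite opprB powRD ?(gt_eqF Mgt0) ?implybT// -powR_mulrn ?(ltW Mgt0)// mulrA.
  have := HM0 _ MM0; rewrite ler_pdivlMr ?mulr_gt0// => H.
  nra.
have c_cvgy := cvg_comp _ _ (intermediate_divn k_cvgy kn_cvg0) b_cvgy.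
near=> n.
have c0 : 0 < b (n %/ k n)%N by near: n; move/cvgryPgt : c_cvgy; exact.
have Mc : t0 / M <= b (n %/ k n)%N by near: n; move/cvgryPge : c_cvgy; exact.
have bound : C * M ^+ 2 * (n%:R / (k n)%:R * p n) <= e'.
  by near: n; exact: (cvgr_le _ p_cvg).
set c := b (n %/ k n)%N in c0 Mc *.
rewrite ler_pdivrMr// mulrC in Mc.
pose r i w := `|c^-1 *: Zs i w|.
pose h i w := r i w ^+ 2 * (M <= r i w)%R%:R.
have mW i : measurable_fun setT ((fun w => c^-1 *: Zs i w) : _ -> Borel V).
  by move=> _ A mA; rewrite setTI; exact: (measurable_scaled c^-1 (Zs_random i) mA).
have mr i : measurable_fun setT (r i).
  exact: measurableT_comp (continuous_Borel nc) (mW i).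
have Pr i u : 0 < u -> P [set w | u <= r i w] = P [set w | u * c <= `|Z w|].
  move=> u0; rewrite -(Zs_law i _ (measurable_norm_ge (u * c))); congr (P _).
  apply/seteqP; split => w /=; rewrite /r nZ ?invr_gt0//.
    by rewrite mulrC ler_pdivlMr.
  by rewrite [X in _ -> is_true (_ <= X)]mulrC ler_pdivlMr.
have h_int i : (\int[P]_w (h i w)%:E <= (4 * M ^+ 2 * p n / (1 - q))%:E)%E.
  rewrite integral_norm_tail.
  have Pdyadic s : M <= s -> (4%:E * P [set w | (2 * s <= r i w)%R] <=
      q%:E * P [set w | (s <= r i w)%R])%E.
    move=> Ms; have s0 : 0 < s by exact: lt_le_trans Ms.
    rewrite !Pr ?mulr_gt0// -mulrA; apply: Gq; apply: le_trans Mc _.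
    by rewrite ler_pM2r.
  have PM : P [set w | M <= r i w] = (p n)%:E.
    rewrite /p fineK; last first.
      by rewrite fin_num_measure//; exact: (measurable_scaled c^-1 Z_random (measurable_norm_ge M)).
    exact: (Zs_law i _ (measurable_scale c^-1 (measurable_norm_ge M))).
  exact: (dyadic_tail (mr i) q0 q1 Mgt0 Pdyadic PM).
have mh i : measurable_fun setT (h i) by exact: measurable_norm_tail (mW i).
have h0 i w : 0 <= h i w by rewrite /h mulr_ge0 ?sqr_ge0.
rewrite -(@lee_pmul2l _ e%:E)// ?lte_fin//.
apply: le_trans (markov_ge0 P (f := fun w => (k n)%:R^-1 * \sum_(i < n) h i w) _ _ e0) _.
- by apply: measurable_funM => //; exact: measurable_sum.
- by move=> w; rewrite mulr_ge0// sumr_ge0.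
under eq_integral do rewrite EFinM.
rewrite ge0_integralZl_EFin//; last 2 first.
- by move=> w _; rewrite lee_fin sumr_ge0.
- by apply/measurable_EFinP; exact: measurable_sum.
under eq_integral do rewrite -sumEFin.
rewrite ge0_integral_sum//; last 2 first.
- by move=> i; apply/measurable_EFinP.
- by move=> i w _; rewrite lee_fin.
apply: (@le_trans _ _ ((k n)%:R^-1%:E * \sum_(i < n) (4 * M ^+ 2 * p n / (1 - q))%:E)%E).
  by rewrite lee_wpmul2l ?lee_fin//; apply: lee_sum.
rewrite sumEFin -!EFinM lee_fin sumr_const card_ord -[X in _ * X]mulr_natr.
rewrite [leLHS](_ : _ = e * (C * M ^+ 2 * (n%:R / (k n)%:R * p n))).
  by rewrite ler_pM2l.
rewrite CE; move: (k n)%:R^-1 (1 - q)^-1 => x y; field.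
by rewrite gt_eqF.
Unshelve. all: by end_near. Qed.

Let c n := b (n %/ k n)%N.
Let W n i w := (c n)^-1 *: Zs i w.
Let rk n w := kth_largest (fun i => `|Zs i w|) n (k n).
Let N u (p : nat * Omega) : R :=
  (k p.1)%:R^-1 * (\sum_(i < p.1) (u <= `|W p.1 i p.2|)%R%:R).

Let alpha_gt0 : 0 < alpha.
Proof. exact: lt_trans alpha_gt2. Qed.

Let c_gt0 : \forall p \near whp P, 0 < c p.1.
Proof.
apply: (@whp_near _ _ _ P [set n | 0 < c n]).
have := cvg_comp _ _ (intermediate_divn k_cvgy kn_cvg0) b_cvgy.
by move/cvgryPgt; exact.
Qed.

Let k_gt0 : \forall p \near whp P, (0 < k p.1)%N.
Proof. by apply: (@whp_near _ _ _ P [set n | 0 < k n]%N); exact: intermediate_gt0. Qed.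

Let k_le : \forall p \near whp P, (k p.1 <= p.1)%N.
Proof. by apply: (@whp_near _ _ _ P [set n | k n <= n]%N); exact: (@intermediate_le R). Qed.

Let W_random n i : random_element (W n i).
Proof.
move=> _ A mA; rewrite setTI; case: Zs_copies => Zs_random _ _.
exact: (measurable_scaled (c n)^-1 (Zs_random i) mA).
Qed.

Lemma norm_count_cvg u : 0 < u -> N u p @[p --> whp P] --> u `^ (- alpha).
Proof.
move=> u0.
have := tail_count_cvg Z_random mu_M0 Z_mu Zs_copies k_cvgy kn_cvg0
  (measurable_norm_ge u) (norm_ge_away u0) (norm_ge_boundary_null u0).
rewrite (measure_norm_ge mu_M0 mu_hom)//=.
rewrite (_ : (fun p => _) = N u)//; apply/funext => p; rewrite /N.
by under eq_bigr do rewrite indic_pred.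
Qed.

(** The threshold is at least [u * c n] exactly when at least [k n] norms are, that
    is when the normalized count [N u] is at least 1; its limit [u `^ (- alpha)]
    is above 1 for [u < 1] and below 1 for [u > 1]. *)
Lemma threshold_bounds (e : R) : 0 < e -> e < 1 ->
  \forall p \near whp P, (1 - e) * c p.1 <= rk p.1 p.2 < (1 + e) * c p.1.
Proof.
move=> e0 e1.
have lo0 : 0 < 1 - e by rewrite subr_gt0.
have hi0 : 0 < 1 + e by rewrite addr_gt0.
have lo : 1 < (1 - e) `^ (- alpha) by apply: powRN_gt1 => //; rewrite lo0 gtrBl.
have hi : (1 + e) `^ (- alpha) < 1 by apply: powRN_lt1; rewrite ?ltrDl.
near=> p.
have c0 : 0 < c p.1 by near: p.
have kp0 : (0 < k p.1)%N by near: p; exact: k_gt0.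
have kpR : 0 < (k p.1)%:R :> R by rewrite ltr0n.
have kp : (0 < k p.1 <= p.1)%N by rewrite kp0; near: p; exact: k_le.
have Nlo : 1 <= N (1 - e) p.
  by near: p; apply: (cvgr_ge _ (norm_count_cvg lo0)).
have Nhi : N (1 + e) p < 1.
  by near: p; apply: (cvgr_lt _ (norm_count_cvg hi0)).
have countE u : (u * c p.1 <= rk p.1 p.2) = (1 <= N u p).
  rewrite kth_largest_ge// /N [X in _ = (1 <= X)]mulrC ler_pdivlMr// mul1r.
  congr (_ <= _); apply: eq_bigr => i _.
  by rewrite normrZ gtr0_norm ?invr_gt0// [in RHS]mulrC ler_pdivlMr.
by rewrite countE Nlo/= ltNge countE -ltNge.
Unshelve. all: by end_near. Qed.

Lemma threshold_ratio : rk p.1 p.2 / c p.1 @[p --> whp P] --> (1 : R).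
Proof.
apply/cvgrPdist_le => e e0.
pose e' := Num.min e 2^-1.
have e'0 : 0 < e' by rewrite lt_min e0 invr_gt0 ltr0n.
have e'1 : e' < 1 by rewrite gt_min invf_lt1 ?ltr1n ?orbT.
have e'e : e' <= e by rewrite ge_min lexx.
near=> p.
have c0 : 0 < c p.1 by near: p.
have /andP[lo hi] : (1 - e') * c p.1 <= rk p.1 p.2 < (1 + e') * c p.1.
  by near: p; exact: threshold_bounds.
move: lo hi; rewrite -ler_pdivlMr// -ltr_pdivrMr// => lo hi.
by rewrite ler_distlC; apply/andP; split; lra.
Unshelve. all: by end_near. Qed.

Variable phi : V -> R.
Hypotheses (phi_cont : continuous phi) (phi_le : forall z, `|phi z| <= `|z| ^+ 2)
  (phiZ : forall t z, phi (t *: z) = t ^+ 2 * phi z).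

Lemma deterministic_threshold_cvg :
  (k p.1)%:R^-1 * (\sum_(i < p.1) phi (W p.1 i p.2) * (1 < `|W p.1 i p.2|)%R%:R)
    @[p --> whp P] --> \int[mu]_(z in [set z | 1 < `|z|]) phi z.
Proof.
have cvg_part (f : V -> R) : continuous f -> (forall z, `|f z| <= `|z| ^+ 2) ->
    (forall t z, f (t *: z) = t ^+ 2 * f z) ->
    mu.-integrable setT (EFin \o tail_positive_part f) /\
    (k p.1)%:R^-1 * (\sum_(i < p.1) tail_positive_part f (W p.1 i p.2))
      @[p --> whp P] --> \int[mu]_z tail_positive_part f z.
  move=> f_cont f_le fZ; split.
    apply: (@tail_functional_integrable _ _ mu) => //.
    - exact: mu_tail_small.
    - exact: tail_positive_part_measurable.
    - exact: tail_positive_part_ge0.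
    - exact: tail_positive_part_le.
    - exact: tail_positive_part_away.
  apply: (@sample_functional_cvg _ _ _ _ P mu k W) => //.
  - exact: (unit_boundary_null mu_M0 mu_hom).
  - exact: (tail_count_cvg Z_random mu_M0 Z_mu Zs_copies k_cvgy kn_cvg0).
  - exact: sample_tail_small.
  - exact: mu_tail_small.
  - exact: tail_positive_part_measurable.
  - exact: tail_positive_part_ge0.
  - exact: tail_positive_part_le.
  - exact: tail_positive_part_away.
  - exact: (tail_positive_part_boundary mu_M0 mu_hom f_cont f_le fZ).
have [ip cp] := cvg_part phi phi_cont phi_le phiZ.
have [|||iN cN] := cvg_part (fun z => - phi z).
- by move=> z; apply: cvgN; exact: phi_cont.
- by move=> z; rewrite normrN.
- by move=> t z; rewrite phiZ mulrN.
have -> : \int[mu]_(z in [set z : V | 1 < `|z|]) phi z =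
    \int[mu]_z tail_positive_part phi z -
    \int[mu]_z tail_positive_part (fun z => - phi z) z.
  rewrite -RintegralB//.
  under [RHS]eq_Rintegral do rewrite tail_positive_partB.
  rewrite /Rintegral integral_mkcond; congr fine; apply: eq_integral => z _.
  rewrite patchE; case: ifPn => [/set_mem/= ->|/negP z1]; first by rewrite mulr1.
  have /negbTE -> : ~~ (1 < `|z|) by apply/negP => h; apply: z1; rewrite inE.
  by rewrite mulr0.
rewrite [X in X @ _ --> _](_ : _ = fun p =>
   (k p.1)%:R^-1 * (\sum_(i < p.1) tail_positive_part phi (W p.1 i p.2)) -
   (k p.1)%:R^-1 * (\sum_(i < p.1) tail_positive_part (fun z => - phi z) (W p.1 i p.2))).
  exact: cvgB.
apply/funext => p; rewrite -mulrBr -sumrB.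
by under [in RHS]eq_bigr do rewrite tail_positive_partB.
Qed.

(** Once the random threshold is within a factor [1 + dlt] or [1 - dlt] of [c n], the
    two sums differ only by rescaled observations of norm between [1 - dlt] and
    [1 + dlt], where the absolute value of [phi] is at most 4. The normalized number of these tends to
    [(1 - dlt) `^ (- alpha) - (1 + dlt) `^ (- alpha)], which is small with [dlt]. *)
Lemma threshold_exchange (e : R) : 0 < e -> \forall p \near whp P,
  `|(k p.1)%:R^-1 * (\sum_(i < p.1) phi (W p.1 i p.2) * (1 < `|W p.1 i p.2|)%R%:R) -
    (k p.1)%:R^-1 * (\sum_(i < p.1) phi (W p.1 i p.2) * (rk p.1 p.2 <= `|Zs i p.2|)%R%:R)|
  <= e.
Proof.
move=> e0.
have [dlt [d0 d1 d_small]] : exists dlt : R, [/\ 0 < dlt, dlt < 1 &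
    4 * ((1 - dlt) `^ (- alpha) - (1 + dlt) `^ (- alpha)) < e].
  have sub_cvg : 1 - x @[x --> (0 : R)^'+] --> (1 : R).
    rewrite -[X in _ --> X]subr0; apply: cvg_at_right_filter.
    by apply: cvgB; [exact: cvg_cst|exact: cvg_id].
  have add_cvg : 1 + x @[x --> (0 : R)^'+] --> (1 : R).
    rewrite -[X in _ --> X]addr0; apply: cvg_at_right_filter.
    by apply: cvgD; [exact: cvg_cst|exact: cvg_id].
  have pc : v `^ (- alpha) @[v --> (1 : R)] --> 1 `^ (- alpha) by exact: continuous_powR_gt0.
  have f_cvg : 4 * ((1 - x) `^ (- alpha) - (1 + x) `^ (- alpha)) @[x --> (0 : R)^'+] -->
      4 * (1 `^ (- alpha) - 1 `^ (- alpha)).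
    apply: cvgM; [exact: cvg_cst|apply: cvgB].
    - exact: (cvg_comp _ _ sub_cvg pc).
    - exact: (cvg_comp _ _ add_cvg pc).
  rewrite subrr mulr0 in f_cvg.
  near (0 : R)^'+ => x; exists x; split; near: x.
  - exact: nbhs_right_gt.
  - exact: nbhs_right_lt.
  - exact: (cvgr_lt _ f_cvg).
have lo0 : 0 < 1 - dlt by rewrite subr_gt0.
have hi0 : 0 < 1 + dlt by rewrite addr_gt0.
have N_cvg : 4 * (N (1 - dlt) p - N (1 + dlt) p) @[p --> whp P] -->
    4 * ((1 - dlt) `^ (- alpha) - (1 + dlt) `^ (- alpha)).
  by apply: cvgM; [exact: cvg_cst|apply: cvgB; exact: norm_count_cvg].
near=> p.
have c0 : 0 < c p.1 by near: p.
have /andP[lo hi] : (1 - dlt) * c p.1 <= rk p.1 p.2 < (1 + dlt) * c p.1.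
  by near: p; exact: threshold_bounds.
have : 4 * (N (1 - dlt) p - N (1 + dlt) p) <= e.
  by near: p; exact: (cvgr_le _ N_cvg).
apply: le_trans.
rewrite /N -!mulrBr -!sumrB normrM ger0_norm// mulrCA ler_wpM2l//.
rewrite (le_trans (ler_norm_sum _ _ _))// mulr_sumr ler_sum// => i _.
have rkE : (rk p.1 p.2 <= `|Zs i p.2|) = (rk p.1 p.2 / c p.1 <= `|W p.1 i p.2|).
  by rewrite /W normrZ gtr0_norm ?invr_gt0// mulrC ler_pM2l ?invr_gt0.
move: lo hi; rewrite -ler_pdivlMr// -ltr_pdivrMr// {}rkE.
move: (rk p.1 p.2 / c p.1) (W p.1 i p.2) => x z lo hi.
rewrite -mulrBr normrM; have := phi_le z => phiz.
have z0 : 0 <= `|z| by [].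
have q0 := normr_ge0 (phi z).
case: (ltP 1 `|z|) => z1; case: (leP x `|z|) => zx;
  case: (leP (1 - dlt) `|z|) => zl; case: (leP (1 + dlt) `|z|) => zh;
  rewrite ?subrr ?subr0 ?sub0r ?normrN ?normr1 ?normr0 ?mulr1 ?mulr0//; try lra; nra.
Unshelve. all: by end_near. Qed.

Lemma random_threshold_cvg :
  (k p.1)%:R^-1 * (\sum_(i < p.1) phi ((rk p.1 p.2)^-1 *: Zs i p.2) *
      (rk p.1 p.2 <= `|Zs i p.2|)%R%:R)
    @[p --> whp P] --> \int[mu]_(z in [set z | 1 < `|z|]) phi z.
Proof.
pose T (p : nat * Omega) :=
  (k p.1)%:R^-1 * (\sum_(i < p.1) phi (W p.1 i p.2) * (1 < `|W p.1 i p.2|)%R%:R).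
pose T' (p : nat * Omega) := (k p.1)%:R^-1 *
  (\sum_(i < p.1) phi (W p.1 i p.2) * (rk p.1 p.2 <= `|Zs i p.2|)%R%:R).
have T'_cvg : T' p @[p --> whp P] --> \int[mu]_(z in [set z | 1 < `|z|]) phi z.
  have D_cvg : T p - T' p @[p --> whp P] --> (0 : R).
    apply/cvgr0Pnorm_le => e e0; exact: threshold_exchange.
  have T_cvg : T p @[p --> whp P] --> \int[mu]_(z in [set z | 1 < `|z|]) phi z.
    exact: deterministic_threshold_cvg.
  rewrite -[X in _ --> X]subr0 (_ : T' = fun p => T p - (T p - T' p)).
    exact: cvgB.
  by apply/funext => p; rewrite subKr.
have ratio_cvg : ((rk p.1 p.2 / c p.1)^-1) ^+ 2 @[p --> whp P] --> (1 : R).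
  have V_cvg : (rk p.1 p.2 / c p.1)^-1 @[p --> whp P] --> (1^-1 : R).
    by apply: cvgV threshold_ratio; exact: oner_neq0.
  have VV_cvg : (rk p.1 p.2 / c p.1)^-1 * (rk p.1 p.2 / c p.1)^-1
      @[p --> whp P] --> (1^-1 * 1^-1 : R) by exact: cvgM.
  by rewrite invr1 mulr1 in VV_cvg.
rewrite -[X in _ --> X]mul1r; apply: cvg_trans (cvgM ratio_cvg T'_cvg).
apply: near_eq_cvg; near=> p => /=.
have c0 : 0 < c p.1 by near: p.
rewrite /T' mulrCA mulr_sumr; congr (_ * _); apply: eq_bigr => i _.
rewrite mulrA -phiZ /W scalerA; congr (phi (_ *: _) * _).
by rewrite invfM invrK -mulrA divff ?mulr1// gt_eqF.
Unshelve. all: by end_near. Qed.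

Lemma random_threshold_cvg_in_probability :
  cvg_in_probability P
    (fun n w => (k n)%:R^-1 * (\sum_(i < n) phi ((rk n w)^-1 *: Zs i w) *
       (rk n w <= `|Zs i w|)%R%:R))
    (\int[mu]_(z in [set z | 1 < `|z|]) phi z).
Proof.
apply: whp_cvg_in_probability random_threshold_cvg => n.
have [Zs_random _ _] := Zs_copies.
have mnorm i : measurable_fun setT (fun w => `|Zs i w|).
  exact: measurableT_comp (continuous_Borel (@norm_continuous _ V)) (Zs_random i).
have mrk : measurable_fun setT (rk n) by exact: measurable_kth_largest.
apply: measurable_funM => //; apply: measurable_sum => i.
under eq_fun do rewrite phiZ.
apply: measurable_funM.
  apply: measurable_funM.
    (* A real power is measurable in its base, and agrees with the inverse on
       nonnegative numbers. *)
    rewrite (_ : (fun w => _) = (fun w => (rk n w ^+ 2) `^ (- 1))).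
      apply: (measurableT_comp (measurable_powR _)).
      exact: measurable_funX.
    by apply/funext => w; rewrite powR_inv1 ?sqr_ge0// exprVn.
  exact: measurableT_comp (continuous_Borel phi_cont) (Zs_random i).
rewrite (_ : (fun w => _) = \1_[set w | 0 <= `|Zs i w| - rk n w]).
  by apply: measurable_indic; apply: measurable_superlevel_ge; exact: measurable_funB.
by apply/funext => w; rewrite indic_pred subr_ge0.
Qed.

End random_threshold.

(** * The inner product of square-integrable functions *)

Section inner_product.
Context (R : realType) (d : measure_display) (T : measurableType d)
  (nu : {measure set T -> \bar R}).
Implicit Types (x y : L2 nu) (a : R).

Let mul_integrable x y : nu.-integrable setT (fun t => (x t * y t)%:E).
Proof.
by apply/Lfun1_integrable; exact: Lfun2_mul_Lfun1 (L2_Lfun x) (L2_Lfun y).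
Qed.

Lemma sqr_L2_norm x : `|x| ^+ 2 = inner x x.
Proof.
rewrite L2_normE sqr_sqrtr//; apply: Rintegral_ge0 => t _.
by rewrite -expr2 sqr_ge0.
Qed.

(** Polarization: with [a = 1] and [a = - 1] this expresses the inner product through
    the norm, so that what follows needs no further integration. *)
Lemma sqr_L2_normDZ x y a :
  `|x + a *: y| ^+ 2 = `|x| ^+ 2 + 2 * a * inner x y + a ^+ 2 * `|y| ^+ 2.
Proof.
rewrite !sqr_L2_norm.
have -> : inner (x + a *: y) (x + a *: y) =
    \int[nu]_t (x t * x t + (2 * a * (x t * y t) + a ^+ 2 * (y t * y t))).
  congr fine; apply: ae_eq_integral => //.
  - by apply/measurable_EFinP; apply: measurable_funM; exact: L2_measurable.
  - apply/measurable_EFinP; apply: measurable_funD.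
      by apply: measurable_funM; exact: L2_measurable.
    apply: measurable_funD; apply: measurable_funM => //;
      by apply: measurable_funM; exact: L2_measurable.
  - apply: filterS2 (L2_addE x (a *: y)) (L2_scaleE a y) => t xay ay _ /=.
    have -> : L2_fun (x + a *: y) t = x t + a * y t.
      by rewrite (xay I) (ay I).
    by congr EFin; ring.
have ix := mul_integrable x x; have iy := mul_integrable y y.
have ixy := mul_integrable x y.
have iZ c (f : T -> R) : nu.-integrable setT (EFin \o f) ->
    nu.-integrable setT (EFin \o (fun t => c * f t)).
  move=> fi; rewrite (_ : _ \o _ = (fun t => c%:E * (EFin \o f) t)%E).
    exact: integrableZl.
  by apply/funext => t /=; rewrite EFinM.
rewrite RintegralD//; last first.
  rewrite (_ : EFin \o _ = (EFin \o (fun t => 2 * a * (x t * y t))) \+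
    (EFin \o (fun t => a ^+ 2 * (y t * y t)))); last by apply/funext.
  by apply: integrableD => //; exact: iZ.
rewrite RintegralD//; [|exact: iZ|exact: iZ].
by rewrite !RintegralZl// addrA.
Qed.

Lemma innerE x y : inner x y = (`|x + y| ^+ 2 - `|x| ^+ 2 - `|y| ^+ 2) / 2.
Proof.
have := sqr_L2_normDZ x y 1; rewrite scale1r => ->.
by field.
Qed.

Lemma inner_le x y : `|inner x y| <= `|x| * `|y|.
Proof.
have xDy : `|x + y| ^+ 2 <= (`|x| + `|y|) ^+ 2.
  by rewrite ler_sqr ?nnegrE ?addr_ge0// ler_normD.
have xBy : `|x - y| ^+ 2 <= (`|x| + `|y|) ^+ 2.
  by rewrite ler_sqr ?nnegrE ?addr_ge0// ler_normB.
have D := sqr_L2_normDZ x y 1; have B := sqr_L2_normDZ x y (- 1).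
rewrite scale1r in D; rewrite scaleN1r in B.
rewrite ler_norml; apply/andP; split; nra.
Qed.

Lemma innerZ x y a : inner (a *: x) (a *: y) = a ^+ 2 * inner x y.
Proof.
rewrite !innerE -scalerDr !normrZ !exprMn real_normK ?num_real//.
by field.
Qed.

Lemma continuous_inner : continuous (fun z : (L2 nu * L2 nu)%type => inner z.1 z.2).
Proof.
under eq_fun do rewrite innerE.
move=> z.
have nrm (f : (L2 nu * L2 nu)%type -> L2 nu) : f y @[y --> z] --> f z ->
    `|f y| ^+ 2 @[y --> z] --> `|f z| ^+ 2.
  by move=> fz; rewrite expr2; apply: cvgM; exact: cvg_norm.
have z1_cvg : y.1 @[y --> z] --> z.1 by exact: cvg_fst.
have z2_cvg : y.2 @[y --> z] --> z.2 by exact: cvg_snd.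
have z12_cvg : y.1 + y.2 @[y --> z] --> z.1 + z.2 by exact: cvgD.
have n1 := nrm _ z1_cvg; have n2 := nrm _ z2_cvg.
have n12 := nrm (fun y : (L2 nu * L2 nu)%type => y.1 + y.2) z12_cvg.
exact: cvgM (cvgB (cvgB n12 n1) n2) (cvg_cst _).
Qed.

Lemma inner_pair_le (z : (L2 nu * L2 nu)%type) : `|inner z.1 z.2| <= `|z| ^+ 2.
Proof.
apply: le_trans (inner_le _ _) _; rewrite expr2.
by apply: ler_pM => //; rewrite /Num.norm/= le_max lexx ?orbT.
Qed.

End inner_product.

Theorem theorem1 (R : realType)
  (d : measure_display) (T : measurableType d) (nu : {measure set T -> \bar R})
  (separable_L2 : separable (L2 nu))
  (d' : measure_display) (Omega : measurableType d') (P : probability Omega R)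
  (X Y : Omega -> L2 nu) (Xs Ys : nat -> Omega -> L2 nu)
  (alpha : R) (mu : {measure set (Borel (L2 nu * L2 nu)%type) -> \bar R})
  (k : nat -> nat)
  (XY_random : random_element (fun w => (X w, Y w)))
  (mean_X : has_mean P X 0) (mean_Y : has_mean P Y 0)
  (alpha_gt2 : 2 < alpha)
  (XY_mu : exponent_measure P (fun w => (X w, Y w)) alpha mu)
  (mu_normalized : normalized mu)
  (mu_nondegenerate : nondegenerate_marginals mu)
  (XYs_copies : independent_copies P (fun w => (X w, Y w))
     (fun i w => (Xs i w, Ys i w)))
  (k_cvgy : k n @[n --> \oo] --> \oo)
  (kn_cvg0 : (k n)%:R / n%:R @[n --> \oo] --> (0 : R)) :
  cvg_in_probability P
    (fun n w => sigma_hat (fun i => Xs i w) (fun i => Ys i w) n (k n))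
    (sigma_XY mu).
Proof.
have [_ mu_M0 mu_hom [b b_cvgy XY_b]] := XY_mu.
exact: (random_threshold_cvg_in_probability alpha_gt2 XY_random mu_M0 mu_hom
  mu_normalized b_cvgy XY_b XYs_copies k_cvgy kn_cvg0
  (@continuous_inner _ _ _ nu) (@inner_pair_le _ _ _ nu)
  (fun t z => innerZ z.1 z.2 t)).
Qed.
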